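(* Let $\mathscr{F}$ be a family of ordered triples of non-negative measurable functions defined on $\mathbb{R}^n$. Suppose there are indices $0<p,q,r<\infty$ satisfying $\frac1r=\frac1p+\frac1q$ such that for every $v,w\in A_1$, $$\left(\int_{\mathbb{R}^n}h(x)^rv(x)^{\frac rp}w(x)^{\frac rq}\,dx\right)^{\frac1r}\le C_0\left(\int_{\mathbb{R}^n}f(x)^pv(x)\,dx\right)^{\frac1p}\left(\int_{\mathbb{R}^n}g(x)^qw(x)\,dx\right)^{\frac1q}$$ for all $(h,f,g)\in\mathscr{F}$ such that the left-hand side is finite, where the constant $C_0$ depends only on $p$, $q$, $[w]_{A_1}$ and $[v]_{A_1}$. Let $p(\cdot),q(\cdot),r(\cdot)\in\mathcal{P}_0$ be exponent functions on $\mathbb{R}^n$ such that $\frac1{r(\cdot)}=\frac1{p(\cdot)}+\frac1{q(\cdot)}$, $0<p<p_-$, $0<q<q_-$, and $\left(\frac{p(\cdot)}p\right)',\left(\frac{q(\cdot)}q\right)'\in\mathscr{B}$. Then $$\|h\|_{L^{r(\cdot)}}\le C\|f\|_{L^{p(\cdot)}}\|g\|_{L^{q(\cdot)}}$$ for all $(h,f,g)\in\mathscr{F}$ such that $h\in L^{r(\cdot)}$, where (given $n$, $p$, $q$ and the dependence of $C_0$ on $[v]_{A_1},[w]_{A_1}$ in the hypothesis) the constant $C$ depends only on $p(\cdot)$ and $q(\cdot)$; in particular it does not depend on the triple $(h,f,g)$.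
   Context: A weight is a non-negative locally integrable function on $\mathbb{R}^n$. The Hardy–Littlewood maximal operator is $\mathcal{M}f(x)=\sup_{B\ni x}\frac1{|B|}\int_B|f|\,dy$ (supremum over balls $B$). $A_1$ is the class of weights $w$ with $\mathcal{M}w\le Cw$ a.e. for some constant $C$, and $[w]_{A_1}=\sup_Q\left(\frac1{|Q|}\int_Qw\,dy\right)\|w^{-1}\|_{L^\infty(Q)}$, supremum over all cubes $Q$. $\mathcal{P}$ (resp. $\mathcal{P}_0$) is the set of measurable functions $p(\cdot):\mathbb{R}^n\to[1,\infty]$ (resp. $(0,\infty]$). Put $p_-=\operatorname{ess\,inf}p(x)$. For $p(\cdot)\in\mathcal{P}_0$, with $\mathbb{R}^n_\infty=\{x:p(x)=\infty\}$, the modular is $\rho_{p(\cdot)}(f)=\int_{\mathbb{R}^n\setminus\mathbb{R}^n_\infty}|f(x)|^{p(x)}dx+\|f\|_{L^\infty(\mathbb{R}^n_\infty)}$, and $L^{p(\cdot)}$ is the space of measurable $f$ with $\rho_{p(\cdot)}(f/\lambda)<\infty$ for some $\lambda>0$, with (quasi-)norm $\|f\|_{L^{p(\cdot)}}=\inf\{\lambda>0:\rho_{p(\cdot)}(f/\lambda)\le1\}$. For $p(\cdot)\in\mathcal{P}$, the conjugate exponent $p'(\cdot)$ (also written $(p(\cdot))'$) is defined pointwise by $\frac1{p(\cdot)}+\frac1{p'(\cdot)}=1$. $\mathscr{B}$ is the family of $p(\cdot)\in\mathcal{P}$ for which there is a constant $C$ with $\|\mathcal{M}f\|_{L^{p(\cdot)}}\le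 C\|f\|_{L^{p(\cdot)}}$ for all $f\in L^{p(\cdot)}$. *)

(* Defs.v *)
From HB Require Import structures.
From mathcomp Require Import all_boot all_order all_algebra.
From mathcomp Require Import all_classical all_reals all_analysis.
From mathcomp Require Import measurable_realfun ess_sup_inf.

Set Implicit Arguments.
Unset Strict Implicit.
Unset Printing Implicit Defensive.

Import Order.TTheory GRing.Theory Num.Theory.
Import numFieldNormedType.Exports.

Local Open Scope classical_set_scope.
Local Open Scope ring_scope.
Local Open Scope ereal_scope.

(** * Lebesgue measure on [R^(n+1)]

    The space [R^d], [d >= 1], is ['rV[R]_n.+1] with [d = n.+1]. Measurable
    sets are the Lebesgue measurable ones, i.e. the sets that are Caratheodory
    measurable for the outer measure generated by the volume of boxes. *)

Section lebesgue_outer.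
Context {R : realType} {n : nat}.
Local Notation V := 'rV[R]_n.+1.

(** The box with corners [I.1] and [I.2]; it is empty, with volume [0], unless
    [I.1] is coordinatewise less than [I.2]. *)
Definition box (I : V * V) : set V :=
  [set x | forall i, (I.1 ord0 i < x ord0 i <= I.2 ord0 i)%R].

Definition box_volume (I : V * V) : R :=
  (\prod_(i < n.+1) Num.max 0 (I.2 ord0 i - I.1 ord0 i))%R.

Definition box_cover (A : set V) : set ((V * V)^nat) :=
  [set I | A `<=` \bigcup_k box (I k)].

Definition lebesgue_outer (A : set V) : \bar R :=
  ereal_inf [set \sum_(k <oo) (box_volume (I k))%:E | I in box_cover A].

Lemma box_volume_ge0 I : (0 <= box_volume I)%R.
Proof. by apply: prodr_ge0 => i _; rewrite le_max lexx. Qed.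

Let vol_ge0 I : 0 <= (box_volume I)%:E.
Proof. by rewrite lee_fin box_volume_ge0. Qed.

Lemma box_volume00 : box_volume (0%R, 0%R) = 0%R.
Proof. by rewrite /box_volume big_ord_recl/= subrr maxxx mul0r. Qed.

Lemma lebesgue_outer_ge0 A : 0 <= lebesgue_outer A.
Proof. by apply: le_ereal_inf_tmp => _ [I _ <-]; exact: nneseries_ge0. Qed.

Lemma lebesgue_outer0 : lebesgue_outer set0 = 0.
Proof.
apply/eqP; rewrite eq_le lebesgue_outer_ge0 andbT.
apply: ereal_inf_lbound; exists (fun=> (0%R, 0%R)); first by [].
by apply: eseries0 => k _ _; rewrite box_volume00.
Qed.

Lemma le_lebesgue_outer :
  {homo lebesgue_outer : A B / A `<=` B >-> A <= B}.
Proof.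
move=> A B AB; apply/ereal_inf_le_tmp => _ [I BI <-].
by exists I => //; exact: subset_trans BI.
Qed.

Lemma lebesgue_outer_sigma_subadditive : sigma_subadditive lebesgue_outer.
Proof.
move=> A; have [[i ioo]|] := pselect (exists i, lebesgue_outer (A i) = +oo).
  rewrite (eseries_pinfty _ _ ioo) ?leey// => k _.
  by rewrite -ltNye (lt_le_trans _ (lebesgue_outer_ge0 _)).
rewrite -forallNE => Aoo.
suff add2e (e : {posnum R}) : lebesgue_outer (\bigcup_n A n) <=
    \sum_(i <oo) lebesgue_outer (A i) + e%:num%:E.
  by apply/lee_addgt0Pr => _/posnumP[].
rewrite (le_trans _ (epsilon_trick _ _ _))//; last first.
  by move=> k; exact: lebesgue_outer_ge0.
pose P k (B : (V * V)^nat) := box_cover (A k) B /\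
  \sum_(j <oo) (box_volume (B j))%:E <=
    lebesgue_outer (A k) + (e%:num / (2 ^ k.+1)%:R)%:E.
have [G PG] : {G : ((V * V)^nat)^nat & forall k, P k (G k)}.
  apply: (@choice _ _ P) => k; rewrite /P.
  have fA : lebesgue_outer (A k) \is a fin_num.
    by rewrite ge0_fin_numE ?lebesgue_outer_ge0// ltey; exact/eqP/Aoo.
  have en1 : (0 < e%:num / (2 ^ k.+1)%:R)%R by [].
  have [_ [B AB <-] Bx] := lb_ereal_inf_adherent en1 fA.
  by exists B; split => //; exact: ltW.
pose vG (ij : nat * nat) := (box_volume (G ij.1 ij.2))%:E.
have vG_ge0 x : 0 <= vG x by exact: vol_ge0.
apply: (@le_trans _ _ (\esum_(i in setT) vG i)).
  apply: ereal_inf_lbound => /=.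
  have /card_esym/ppcard_eqP[f] := card_nat2.
  exists (fun k => G (f k).1 (f k).2).
    move=> t [i _ /(PG i).1 [j _ Gt]]; exists (f^-1%FUN (i, j)) => //=.
    by rewrite invK ?inE.
  rewrite -(esum_pred_image vG f xpredT) ?[fun=> _]set_true//.
  by rewrite image_eq.
rewrite (_ : esum _ _ = \sum_(i <oo) \sum_(j <oo) vG (i, j)); last first.
  pose J : nat -> set (nat * nat) := fun i => [set (i, j) | j in setT].
  rewrite (_ : setT = \bigcup_k J k); last first.
    by rewrite predeqE => -[a b]; split => // _; exists a => //; exists b.
  rewrite esum_bigcupT//=; last first.
    apply/trivIsetP => i j _ _ ij.
    rewrite predeqE => -[k m] /=; split => //= -[] [_] _ [<-{k} _].
    by move=> [m' _] [] /esym/eqP; rewrite (negbTE ij).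
  rewrite -(image_id [set: nat]) -fun_true esum_pred_image//; last first.
    by move=> k _; exact: esum_ge0.
  apply: eq_eseriesr => /= j _.
  rewrite -(esum_pred_image vG (pair j) predT)//=; last first.
    by move=> ? ? _ _; exact: (@can_inj _ _ _ snd).
  by congr esum; rewrite predeqE => -[a b]; split; move=> [i _ <-]; exists i.
apply: lee_nneseries => [i _ _|i _]; first exact: nneseries_ge0.
exact: (PG i).2.
Qed.

HB.instance Definition _ := isOuterMeasure.Build R V lebesgue_outer
  lebesgue_outer0 lebesgue_outer_ge0 le_lebesgue_outer
  lebesgue_outer_sigma_subadditive.

End lebesgue_outer.

(** [Rn R n] is ['rV[R]_n.+1] with its Lebesgue sigma-algebra. *)
Notation Rn R n := (caratheodory_type (@lebesgue_outer R n)).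

Section lebesgue_Rn.
Context {R : realType} {n : nat}.

Definition leb : set (Rn R n) -> \bar R := @lebesgue_outer R n.

Let leb0 : leb set0 = 0. Proof. exact: lebesgue_outer0. Qed.

Let leb_ge0 A : 0 <= leb A. Proof. exact: lebesgue_outer_ge0. Qed.

Let leb_semi_sigma_additive : semi_sigma_additive leb.
Proof. exact: caratheodory_measure_sigma_additive. Qed.

HB.instance Definition _ := isMeasure.Build _ _ _ leb
  leb0 leb_ge0 leb_semi_sigma_additive.

End lebesgue_Rn.

Section maximal_and_weights.
Context {R : realType} {n : nat}.
Local Notation T := (Rn R n).
Local Notation V := 'rV[R]_n.+1.
Local Notation mu := (@leb R n).

(** The library's [ball] on ['rV[R]_n.+1] is the one of the supremum norm. *)
Definition euclidean_ball (c : V) (s : R) : set T :=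
  [set x : V | Num.sqrt (\sum_(i < n.+1) (x ord0 i - c ord0 i) ^+ 2) < s]%R.

(** Cubes have their sides parallel to the coordinate axes. *)
Definition cube (c : V) (s : R) : set T :=
  [set x : V | forall i, `|x ord0 i - c ord0 i| < s]%R.

Definition mean (f : T -> \bar R) (A : set T) : \bar R :=
  (mu A)^-1 * \int[mu]_(y in A) `|f y|.

Definition maximal (f : T -> \bar R) (x : T) : \bar R :=
  ereal_sup [set z | exists c s, [/\ (0 < s)%R, euclidean_ball c s x &
                                    z = mean f (euclidean_ball c s)]].

Definition weight (w : T -> R) : Prop :=
  [/\ measurable_fun setT w, forall x, (0 <= w x)%R &
      forall K : set V, compact K -> \int[mu]_(x in K) (w x)%:E < +oo].

Definition A1 (w : T -> R) : Prop :=
  weight w /\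
  exists C : R, \forall x \ae mu, maximal (EFin \o w) x <= C%:E * (w x)%:E.

(** The reciprocal is that of [\bar R], for which [0^-1 = +oo]. *)
Definition A1_const (w : T -> R) : \bar R :=
  ereal_sup [set z | exists c s, (0 < s)%R /\
    z = mean (EFin \o w) (cube c s) *
        'N[mu]_+oo[(fun y => (w y)%:E^-1) \_ (cube c s)]].

End maximal_and_weights.

Section variable_exponents.
Context {R : realType} {n : nat}.
Local Notation T := (Rn R n).
Local Notation mu := (@leb R n).
Implicit Types (p : T -> \bar R) (f : T -> \bar R).

Definition exponentP0 p : Prop :=
  measurable_fun setT p /\ forall x, 0 < p x.

Definition exponentP p : Prop :=
  measurable_fun setT p /\ forall x, 1 <= p x.

Definition modular p f : \bar R :=
  \int[mu]_(x in [set x | p x != +oo]) `|f x| `^ fine (p x) +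
  'N[mu]_+oo[f \_ [set x | p x = +oo]].

Definition var_Lp p f : Prop :=
  measurable_fun setT f /\
  exists2 l : R, (0 < l)%R & modular p (fun x => f x / l%:E) < +oo.

(** This is [+oo] when [f] is not in the space. *)
Definition var_norm p f : \bar R :=
  ereal_inf [set l%:E | l in
    [set l : R | (0 < l)%R /\ modular p (fun x => f x / l%:E) <= 1]].

(** At a point where [0 < p x < 1], [hoelder_conjugate (p x)] is negative;
    hence [exponentP (conj_exponent p)] with [p] positive forces [1 <= p]. *)
Definition conj_exponent p : T -> \bar R := fun x => hoelder_conjugate (p x).

Definition maximal_bounded p : Prop :=
  exponentP p /\
  exists C : R, forall f, var_Lp p f ->
    var_norm p (maximal f) <= C%:E * var_norm p f.

Definition nonneg_measurable f : Prop :=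
  measurable_fun setT f /\ forall x, 0 <= f x.

End variable_exponents.

(* Main.v *)
Require Import Defs.
From HB Require Import structures.
From mathcomp Require Import all_boot all_order all_algebra.
From mathcomp Require Import all_classical all_reals all_analysis.
From mathcomp Require Import measurable_realfun ess_sup_inf.
From mathcomp Require Import ring lra.
Set Implicit Arguments.
Unset Strict Implicit.
Unset Printing Implicit Defensive.
Import Order.TTheory GRing.Theory Num.Theory.
Import numFieldNormedType.Exports.
Local Open Scope classical_set_scope.
Local Open Scope ring_scope.
Local Open Scope ereal_scope.

(** Put [s] for the conjugate exponent of [pv / p] and [t] for that of [qv / q].
    From [1 / rv = 1 / pv + 1 / qv] and [1 / r = 1 / p + 1 / q] one gets, at
    almost every point,
      [r / rv + (r / p) / s + (r / q) / t = 1].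
    Hence a density [Phi] of mass at most [1] splits into a norming factor for
    [h ^ r] and the two functions [Phi ^ (1 / s)] and [Phi ^ (1 / t)], whose
    modulars for [s] and [t] are at most [1]. The boundedness of the maximal
    operator on the spaces of exponents [s] and [t] turns these two functions
    into [A_1] weights [v] and [w] that dominate them up to a factor [2] and
    keep modulars at most [2] ([rubio_de_francia], [A1_weight_of_density]). The
    weighted hypothesis for [v] and [w] then gives the unweighted conclusion:
    its right-hand side is at most a constant times [var_norm pv f] times
    [var_norm qv g] by duality ([pairing_var_norm_le]), its left-hand side is
    finite ([bilinear_integral_lty]), and it is at least a constant times
    [var_norm rv h] when [Phi] is a norming density for [h] ([norming_density],
    [bilinear_integral_ge]).

    The function [C0] is arbitrary: it need not be monotone, so a bound on the
    [A_1] constants of weights that vary with the triple would not bound the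
    values of [C0]. The constant [C] is therefore obtained by contradiction. If
    no constant works, then for every [k] some triple, taken from some family
    that satisfies the hypothesis, violates the conclusion with a constant
    [N k] that grows fast. Let [phi k] be the norming density of the [k]-th
    triple. The single density [Phi = \sum_k 2 ^- k.+1 * phi k]
    ([common_density]) still norms every triple, at the cost of the factor
    [2 ^- k.+1]; it produces one pair of weights [v] and [w], and so one value
    of [C0], for the whole sequence. When [N k] outgrows the loss, the
    inequalities of the sequence bound every natural number by one constant. *)

(** * Extended real numbers and their powers *)

Section ereal_series.
Context {R : realType}.
Implicit Types (a b : \bar R) (f : nat -> \bar R).

(** The factor may be [+oo], as happens for the reciprocal of the measure of a
    null set. *)
Lemma mule_nneseries_le a f : 0 <= a -> (forall k, 0 <= f k) ->
  a * (\sum_(k <oo) f k) <= \sum_(k <oo) a * f k.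
Proof.
case: a => [r a0 f0|a0 f0|//]; first by rewrite nneseriesZl.
have [S0|[k fk]] : \sum_(k <oo) f k = 0 \/ exists k, f k != 0.
  have [?|/forallNP h] := pselect (exists k, f k != 0); [by right|left].
  apply: eseries0 => k _ _.
  by apply/eqP; rewrite -[_ == _]negbK; exact/negP/h.
- by rewrite S0 mule0; apply: nneseries_ge0 => k _ _; rewrite mule_ge0.
- have fky : +oo * f k = +oo by rewrite gt0_mulye// lt0e fk f0.
  rewrite (eseries_pinfty _ _ fky) ?leey// => j _.
  by rewrite -ltNye (lt_le_trans ltNy0)// mule_ge0.
Qed.

Lemma nneseries_half_le (b : \bar R) : 0 <= b ->
  \sum_(j <oo) (2 ^- j.+1)%:E * b <= b.
Proof.
case: b => [b b0|_|//]; last by rewrite leey.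
apply: lime_le.
  by apply: is_cvg_nneseries => k _ _; rewrite mule_ge0// lee_fin.
apply: nearW => k; rewrite -ge0_sume_distrl//.
rewrite -[leRHS]mul1e lee_wpmul2r// sumEFin lee_fin.
suff -> : (\sum_(0 <= i < k) 2 ^- i.+1 = 1 - 2 ^- k :> R)%R.
  by rewrite gerBl.
elim: k => [|k IH]; first by rewrite big_nil expr0 invr1 subrr.
rewrite big_nat_recr//= IH exprS invfM; have := divff (lt0r_neq0 (ltr0Sn R 1)); lra.
Qed.


Lemma divEFin (x : \bar R) (l : R) : (0 < l)%R -> x / l%:E = (l^-1)%:E * x.
Proof. by move=> l0; rewrite inver gt_eqF// muleC. Qed.


Lemma lt_ereal_real_between (x y : \bar R) : 0 <= x -> x < y ->
  exists l : R, [/\ (0 < l)%R, x < l%:E & l%:E < y].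
Proof.
case: x y => [x| |] [y| |]//; rewrite ?lee_fin ?lte_fin => x0 xy.
  by exists ((x + y) / 2)%R; rewrite !lte_fin; split; lra.
by exists (x + 1)%R; rewrite lte_fin ltry; split=> //; lra.
Qed.


End ereal_series.


Section powers.
Context {R : realType}.
Implicit Types (u m : \bar R).

(** The power is split according to the conventions at [+oo], [-oo] and [0], so
    that only [expR] and [ln] of real functions remain. *)
Lemma measurable_poweR_fun d (T : measurableType d) (f : T -> \bar R) (e : T -> R) :
  measurable_fun setT f -> measurable_fun setT e ->
  measurable_fun setT (fun x => f x `^ e x).
Proof.
move=> mf me.
rewrite (_ : (fun _ => _) = (fun x =>
  if f x == +oo then (if e x == 0%R then 1 else +oo) else
  if f x == -oo then (if e x == 0%R then 1 else 0) else
  (if fine (f x) == 0%R then (e x == 0%R)%:R else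
     expR (e x * ln (fine (f x))))%:E)); last first.
  by apply/funext => x; case: (f x).
have me0 : measurable_fun setT (fun x => e x == 0%R).
  exact: measurable_fun_eqr.
have mff : measurable_fun setT (fun x => fine (f x)).
  by apply: measurableT_comp => //; exact: fine_measurable.
apply: measurable_fun_ifT; [exact: measurable_fun_eqe|exact: measurable_fun_ifT|].
apply: measurable_fun_ifT; [exact: measurable_fun_eqe|exact: measurable_fun_ifT|].
apply/measurable_EFinP; apply: measurable_fun_ifT.
- exact: measurable_fun_eqr.
- rewrite (_ : (fun _ => _) = (fun x => if e x == 0%R then 1%R else 0%R : R)).
    exact: measurable_fun_ifT.
  by apply/funext => x; case: ifP.
- apply: measurableT_comp => //; apply: measurable_funM => //.
  by apply: measurableT_comp => //; exact: measurable_ln.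
Qed.

Lemma measurable_poweR_cst d (T : measurableType d) (f : T -> \bar R) (c : R) :
  measurable_fun setT f -> measurable_fun setT (fun x => f x `^ c).
Proof.
by move=> mf; apply: measurable_poweR_fun; [exact: mf|exact: measurable_cst].
Qed.

Lemma measurable_fine_fun d (T : measurableType d) (e : T -> \bar R) :
  measurable_fun setT e -> measurable_fun setT (fun x => fine (e x)).
Proof. by move=> me; apply: measurableT_comp => //; exact: fine_measurable. Qed.

Lemma measurable_EFin_fun d (T : measurableType d) (v : T -> R) :
  measurable_fun setT v -> measurable_fun setT (fun x => (v x)%:E).
Proof. by move=> mv; exact/measurable_EFinP. Qed.

Lemma le_poweR2 (r : R) u m : (0 <= r)%R -> 0 <= u -> u <= m ->
  u `^ r <= m `^ r.
Proof.
move=> r0 u0 um; apply: gt0_ler_poweR => //; rewrite in_itv/= ?u0 ?leey//.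
by rewrite (le_trans u0 um).
Qed.

(** With [u = f x / l] and [e] the exponent at [x], this treats finite and
    infinite exponents at once: [(fine +oo)^-1 = 0], so that at an infinite
    exponent the bound is [m `^ 0 = 1]. Multiplying such bounds along exponents of sum
    [1] gives the inequalities of Young and of Hoelder, since the powers of the
    common majorant [m] recombine into [m]. *)
Lemma le_poweR_exponent (e u m : \bar R) (p : R) : (0 <= p)%R -> 0 < e -> 0 <= u ->
  (e = +oo -> u <= 1) -> (e != +oo -> u `^ fine e <= m) ->
  u `^ p <= m `^ (p * (fine e)^-1).
Proof.
case: e => [e||] p0 e0 u0 u1 um; last by [].
  have {}e0 : (0 < e)%R by rewrite -lte_fin.
  rewrite (_ : u `^ p = (u `^ e) `^ (p * e^-1)); last first.
    by rewrite -poweRrM mulrCA divff ?mulr1// gt_eqF.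
  apply: le_poweR2; [|exact: poweR_ge0|exact: um].
  by rewrite divr_ge0// ltW.
rewrite /= invr0 mulr0 poweRe0 -(poweR1r p); apply: le_poweR2 => //; exact: u1.
Qed.

Lemma poweR_prod2 (a b : R) m : (0 <= a)%R -> (0 <= b)%R -> (a + b = 1)%R ->
  0 <= m -> m `^ a * m `^ b = m.
Proof.
move=> a0 b0 ab m0; rewrite -poweRD ?ab ?poweRe1//.
by apply: add_neq0_poweRD_def; rewrite ab oner_neq0.
Qed.

(** The sum [a + b] can vanish, in which case [m `^ a * m `^ b = 1] even for
    [m = 0] and [m = +oo]. *)
Lemma poweR_prod3 (a b c : R) m : (0 <= a)%R -> (0 <= b)%R -> (0 <= c)%R ->
  (a + b + c = 1)%R -> 0 <= m -> m `^ a * m `^ b * m `^ c = m.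
Proof.
move=> a0 b0 c0 abc m0; have [ab|ab] := eqVneq (a + b)%R 0%R.
  have /andP[/eqP a_0 /eqP b_0] : (a == 0%R) && (b == 0%R) by rewrite -paddr_eq0 ?ab.
  move: abc; rewrite a_0 b_0 !add0r => ->.
  by rewrite !poweRe0 !mul1e poweRe1.
rewrite -poweRD ?poweR_prod2 ?addr_ge0//.
exact: add_neq0_poweRD_def.
Qed.

(** Since [\sum_j 2 ^- j.+1 = 1], the left-hand series is an average of the
    numbers [2 ^- j * x j], each of which is at most the [e]-th root of the
    right-hand side because [(2 ^- j) `^ e <= 2 ^- j]. Spending the extra factor
    [2 ^- j] in this way replaces the convexity of the power for infinite
    averages. *)
Lemma poweR_nneseries_le (e : R) (x : nat -> \bar R) : (1 <= e)%R ->
  (forall j, 0 <= x j) ->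
  (\sum_(j <oo) (2 ^- j.+1 * 2 ^- j)%:E * x j) `^ e <=
  \sum_(j <oo) (2 ^- j)%:E * x j `^ e.
Proof.
move=> e1 x0; set S := (X in _ <= X).
have e0 : (0 < e)%R by exact: lt_le_trans e1.
have px0 j : 0 <= (2 ^- j)%:E * x j `^ e by rewrite mule_ge0 ?poweR_ge0// lee_fin.
have S0 : 0 <= S by exact: nneseries_ge0.
rewrite (_ : S = (S `^ e^-1) `^ e); last first.
  by rewrite -poweRrM mulVf ?gt_eqF// poweRe1.
apply: le_poweR2; [exact: ltW| |].
  by apply: nneseries_ge0 => j _ _; rewrite mule_ge0// lee_fin mulr_ge0.
apply: (@le_trans _ _ (\sum_(j <oo) (2 ^- j.+1)%:E * S `^ e^-1)); last first.
  by apply: nneseries_half_le; exact: poweR_ge0.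
apply: lee_nneseries => [j _ _|j _].
  by rewrite mule_ge0// lee_fin mulr_ge0.
rewrite EFinM -muleA lee_wpmul2l ?lee_fin//.
have tx0 : 0 <= (2 ^- j)%:E * x j by rewrite mule_ge0// lee_fin.
rewrite (_ : _ * _ = (((2 ^- j)%:E * x j) `^ e) `^ e^-1); last first.
  by rewrite -poweRrM divff ?gt_eqF// poweRe1.
apply: le_poweR2; [by rewrite invr_ge0 ltW|exact: poweR_ge0|].
apply: (@le_trans _ _ ((2 ^- j)%:E * x j `^ e)).
  rewrite poweRM// ?lee_fin// lee_wpmul2r ?poweR_ge0// poweR_EFin lee_fin.
  apply: ge1r_powR => //; rewrite invr_gt0 exprn_gt0//=.
  by rewrite invf_le1 ?exprn_gt0// exprn_ege1// ler1n.
apply: le_trans; last exact: (nneseries_lim_ge j.+1).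
by rewrite big_nat_recr//= leeDr// sume_ge0.
Qed.

End powers.

(** * Lebesgue measurable sets *)

Section lebesgue_sets.
Context {R : realType} {n : nat}.
Local Notation T := (Rn R n).
Local Notation V := 'rV[R]_n.+1.
Local Notation mu := (@leb R n).

Let upd (x : V) (i : 'I_n.+1) (c : R) : V :=
  \row_j if j == i then c else x ord0 j.

(** The lengths of the two pieces into which the point [c] cuts the interval from
    [a] to [b]. *)
Lemma max0_split (a b c : R) :
  (Num.max 0 (Num.min b c - a) + Num.max 0 (b - Num.max a c) =
   Num.max 0 (b - a))%R.
Proof.
have [bc|cb] := leP b c; have [ac|ca] := leP a c.
- by rewrite [X in (_ + X)%R]max_l ?addr0 ?subr_le0.
- have ba : (b - a <= 0)%R by rewrite subr_le0 (le_trans bc)// ltW.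
  by rewrite (max_l ba) addr0.
- rewrite !max_r ?subr_ge0//; [lra|exact: le_trans (ltW cb)|exact: ltW].
- by rewrite [X in (X + _)%R]max_l ?add0r// subr_le0 ltW.
Qed.

Let box_volume_split (I : V * V) i c :
  (box_volume (I.1, upd I.2 i (Num.min (I.2 ord0 i) c)) +
   box_volume (upd I.1 i (Num.max (I.1 ord0 i) c), I.2) = box_volume I)%R.
Proof.
rewrite /box_volume (bigD1 i)//= [X in (_ + X)%R](bigD1 i)//=.
rewrite [in RHS](bigD1 i)//= !mxE eqxx -(max0_split (I.1 ord0 i) (I.2 ord0 i) c) mulrDl.
by congr (_ + _)%R; congr (_ * _)%R; apply: eq_bigr => j /negbTE ji;
  rewrite !mxE ji.
Qed.

(** A half-space cuts each box of a cover into two boxes whose volumes add up, so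
    covers of a set split into covers of its two parts. *)
Lemma measurable_halfspace i (c : R) :
  measurable ([set x : V | (x ord0 i <= c)%R] : set T).
Proof.
apply: le_caratheodory_measurable => X.
apply: le_ereal_inf_tmp => _ [I XI <-].
pose J k := ((I k).1, upd (I k).2 i (Num.min ((I k).2 ord0 i) c)).
pose K k := (upd (I k).1 i (Num.max ((I k).1 ord0 i) c), (I k).2).
rewrite [leRHS](_ : _ = \sum_(k <oo) (box_volume (J k))%:E +
                      \sum_(k <oo) (box_volume (K k))%:E); last first.
  rewrite -nneseriesD; last 2 first.
  - by move=> k _ _; rewrite lee_fin box_volume_ge0.
  - by move=> k _ _; rewrite lee_fin box_volume_ge0.
  by apply: eq_eseriesr => k _; rewrite -EFinD box_volume_split.
apply: leeD; apply: ereal_inf_lbound.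
  exists J => // x [Xx xc]; have [k _ Ik] := XI _ Xx.
  exists k => // j; have /andP[jl jr] := Ik j; rewrite /J/= mxE jl/=.
  by case: eqP => [ji|]//; rewrite le_min ji xc andbT -ji jr.
exists K => // x [Xx /negP]; rewrite -ltNge => xc; have [k _ Ik] := XI _ Xx.
exists k => // j; have /andP[jl jr] := Ik j; rewrite /K/= mxE jr andbT.
by case: eqP => [ji|]//; rewrite gt_max ji xc -ji jl.
Qed.

Lemma measurable_coord i : measurable_fun setT (fun x : T => (x : V) ord0 i).
Proof.
apply: (measurability _ (RGenOInfty.measurableE R)) => _ [_ [c ->] <-].
rewrite setTI (_ : _ @^-1` _ = ~` [set x : V | (x ord0 i <= c)%R]).
  exact/measurableC/measurable_halfspace.
by apply/seteqP; split => x /=; rewrite in_itv/= andbT ltNge => /negP.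
Qed.

Lemma measurable_cube (c : V) (s : R) : measurable (cube c s : set T).
Proof.
rewrite (_ : cube c s =
  \bigcap_i ((fun x : T => (x : V) ord0 i) @^-1` (ball (c ord0 i) s))).
  apply: fin_bigcap_measurable => // i _.
  rewrite -[X in measurable X]setTI.
  by apply: measurable_coord => //; exact: measurable_ball.
apply/seteqP; split => [x cx i _|x cx i] /=.
  by rewrite /ball/= distrC; exact: cx.
by have := cx i I; rewrite /preimage/ball/= distrC.
Qed.

(** An open set is the union of the cubes with rational centres and radii
    [1 / (k + 1)] that it contains. *)
Lemma open_measurable_Rn (U : set V) : open U -> measurable (U : set T).
Proof.
move=> oU.
pose Q (q : 'rV[rat]_n.+1 * nat) : set T :=
  cube (map_mx ratr q.1) (q.2.+1%:R^-1).
pose W q := if pselect (Q q `<=` U) then Q q else set0.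
rewrite (_ : U = \bigcup_q W q).
  apply: (@countable_bigcupT_measurable _ T _ W) => [|q].
    exact: countableP.
  by rewrite /W; case: pselect => [?|?]; [exact: measurable_cube|exact: measurable0].
apply/seteqP; split => [x Ux|x [q _]]; last first.
  by rewrite /W; case: pselect => [QU /QU|?] //.
have /nbhs_ballP[e /= e0 xe] : nbhs x U by exact: open_nbhs_nbhs.
have [k ke] : exists k : nat, (k.+1%:R^-1 < e / 2 :> R)%R.
  have e20 : (0 < e / 2)%R by rewrite divr_gt0.
  by have [k] := ltr_add_invr e20; rewrite add0r; exists k.
have k0 : (0 < k.+1%:R^-1 :> R)%R by rewrite invr_gt0.
have /choice[g gP] (i : 'I_n.+1) :
    exists y : rat, (`|x ord0 i - ratr y| < k.+1%:R^-1)%R.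
  have /rat_in_itvoo[y] : (x ord0 i - k.+1%:R^-1 < x ord0 i + k.+1%:R^-1)%R.
    by rewrite ltrBlDr -addrA ltrDl addr_gt0.
  rewrite in_itv/= => /andP[yl yr]; exists y.
  by rewrite ltr_distlC yl yr.
exists (\row_i g i, k) => //; rewrite /W; case: pselect => [?|].
  by move=> i; rewrite !mxE.
move=> QU; exfalso; apply: QU => y Qy; apply: xe; split=> // i j; rewrite (ord1 i) /ball/=.
have := Qy j; have := gP j; rewrite !mxE/= => xg yg.
rewrite -(subrK (ratr (g j)) (x ord0 j)) -addrA.
rewrite (le_lt_trans (ler_normD _ _))// [ltRHS](splitr e).
by rewrite ltrD// (lt_trans _ ke)// distrC.
Qed.

(** One half-open box covers the cube; the other boxes of the cover are empty. *)
Lemma leb_cube_fin (c : V) (s : R) : mu (cube c s) < +oo.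
Proof.
pose I k : V * V := if k is 0%N then (\row_i (c ord0 i - s), \row_i (c ord0 i + s))%R
  else (0%R, 0%R).
apply: (@le_lt_trans _ _ (\sum_(k <oo) (box_volume (I k))%:E)).
  apply: ereal_inf_lbound; exists I => // x cx; exists 0%N => // i.
  rewrite /I /= !mxE; have := cx i; rewrite ltr_norml; lra.
rewrite nneseries_recl//; last by move=> k _; rewrite lee_fin box_volume_ge0.
rewrite eseries0 ?adde0 ?ltry// => -[//|k] _ _ /=.
by rewrite box_volume00.
Qed.

Lemma coord_le_norm (x : V) i : (`|x ord0 i| <= `|x|)%R.
Proof.
rewrite [leRHS]/Num.Def.normr/= mx_normrE.
exact: (@le_bigmax _ _ _ 0%R (fun ij => `|x ij.1 ij.2|)%R (ord0, i)).
Qed.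

Lemma cube_exhausts (x : V) : exists k : nat, cube 0%R k%:R x.
Proof.
exists (Num.bound `|x|)%R => i; rewrite mxE subr0.
rewrite (le_lt_trans _ (archi_boundP _))//.
exact: coord_le_norm.
Qed.

Lemma compact_cube (K : set V) : compact K -> exists k : nat, K `<=` cube 0%R k%:R.
Proof.
move=> /compact_bounded[M [Mreal KM]].
exists (Num.bound (`|M| + 1))%R => x Kx i; rewrite mxE subr0.
rewrite (le_lt_trans _ (archi_boundP _))// (le_trans (coord_le_norm _ _))//.
by apply: KM Kx; rewrite (le_lt_trans (ler_norm M))// ltrDl.
Qed.

Lemma compact_measurable_Rn (K : set V) : compact K -> measurable (K : set T).
Proof.
move=> cK; have cl : closed K by apply: compact_closed cK; exact: norm_hausdorff.
rewrite -[X in measurable X]setCK; apply: measurableC.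
by apply: open_measurable_Rn; exact: closed_openC.
Qed.

Lemma open_euclidean_ball (c : V) (s : R) : open (euclidean_ball c s : set V).
Proof.
have cS : continuous (fun x : V =>
    \sum_(i < n.+1) (x ord0 i - c ord0 i) ^+ 2 : R)%R.
  apply: continuous_big => [|i _ x]; first exact: add_continuous.
  apply: (@continuous_comp _ _ _ (fun x : V => (x ord0 i - c ord0 i)%R : R)
    (fun y : R => y ^+ 2)%R); last exact: exprn_continuous.
  apply: (@cvgB R R V (nbhs x) _ (fun x : V => x ord0 i) (fun=> c ord0 i)).
    exact: (@coord_continuous R 1 n.+1 ord0 i x).
  exact: cvg_cst.
have cf : continuous (fun x : V =>
    Num.sqrt (\sum_(i < n.+1) (x ord0 i - c ord0 i) ^+ 2)%R : R).
  move=> x; apply: (@continuous_comp _ _ _ _ (@Num.sqrt R)); first exact: cS.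
  exact: sqrt_continuous.
have /continuousP/(_ [set y | y < s]%R) := cf; apply; exact: open_lt.
Qed.

Lemma measurable_euclidean_ball (c : V) (s : R) :
  measurable (euclidean_ball c s : set T).
Proof. exact/open_measurable_Rn/open_euclidean_ball. Qed.

Lemma positive_measure_in_cube (E : set T) : measurable E -> 0 < mu E ->
  exists k : nat, 0 < mu (E `&` cube 0%R k%:R).
Proof.
move=> mE E0; apply: contrapT => /forallNP h.
have mEk k : measurable (E `&` cube 0%R k%:R).
  by apply: measurableI => //; exact: measurable_cube.
have : mu (\bigcup_k (E `&` cube 0%R k%:R)) = 0.
  apply: (proj1 (negligibleP _ (bigcupT_measurable _ mEk))).
  apply: negligible_bigcup => k; apply/(negligibleP _ (mEk k)).
  by apply/eqP; rewrite -measure_le0 leNgt; exact/negP/h.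
rewrite -setI_bigcupr (_ : \bigcup_k _ = setT) ?setIT.
  by move=> mE0; rewrite mE0 ltxx in E0.
by apply/seteqP; split=> // x _; have [k] := cube_exhausts x; exists k.
Qed.


End lebesgue_sets.

(** * The maximal operator *)

Section maximal_operator.
Context {R : realType} {n : nat}.
Local Notation T := (Rn R n).
Local Notation V := 'rV[R]_n.+1.
Local Notation mu := (@leb R n).
Implicit Types f g : T -> \bar R.

(** The superlevel sets of a maximal function are unions of open balls. *)
Lemma maximal_measurable f : measurable_fun setT (maximal f).
Proof.
apply: (measurability _ (ErealGenOInfty.measurableE R)) => _ [_ [a ->] <-].
rewrite setTI; apply: open_measurable_Rn; rewrite openE => x /=.
rewrite /preimage/= in_itv/= andbT => /ereal_sup_gt[z [c [s [s0 cx ->]]] az].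
have : nbhs (x : V) (euclidean_ball c s : set V).
  by apply: open_nbhs_nbhs; split=> //; exact: open_euclidean_ball.
apply: filterS => y cy; rewrite /= in_itv/= andbT (lt_le_trans az)//.
by apply: ereal_sup_ubound; exists c, s.
Qed.

Lemma inve_mu_ge0 (A : set T) : 0 <= (mu A)^-1.
Proof. by rewrite inve_ge0. Qed.

Lemma mean_ge0 f A : 0 <= mean f A.
Proof. by rewrite mule_ge0 ?inve_mu_ge0// integral_ge0. Qed.

Lemma maximal_ge0 f x : 0 <= maximal f x.
Proof.
apply: le_ereal_sup_tmp; exists (mean f (euclidean_ball x 1%R)); last exact: mean_ge0.
exists x, 1%R; split => //=.
by rewrite /euclidean_ball/= big1 ?sqrtr0// => i _; rewrite subrr expr0n.
Qed.

Lemma le_maximal f g x : measurable_fun setT f -> measurable_fun setT g ->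
  (forall x, 0 <= f x) -> (forall x, f x <= g x) -> maximal f x <= maximal g x.
Proof.
move=> mf mg f0 fg; apply: ge_ereal_sup => _ [c [s [s0 cx ->]]].
apply: le_trans; last by apply: ereal_sup_ubound; exists c, s.
rewrite lee_wpmul2l ?inve_mu_ge0//.
have mB := measurable_euclidean_ball c s.
apply: ge0_le_integral.
- exact: mB.
- by move=> y _; exact: abse_ge0.
- by apply: measurableT_comp; [exact: abse_measurable|exact: measurable_funTS].
- by apply: measurableT_comp; [exact: abse_measurable|exact: measurable_funTS].
- by move=> y _; rewrite !gee0_abs// (le_trans (f0 y)).
Qed.

(** Countable subadditivity, by monotone convergence in each mean. *)
Lemma maximal_nneseries (f : nat -> T -> \bar R) x :
  (forall k, measurable_fun setT (f k)) -> (forall k x, 0 <= f k x) ->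
  maximal (fun y => \sum_(k <oo) f k y) x <= \sum_(k <oo) maximal (f k) x.
Proof.
move=> mf f0; apply: ge_ereal_sup => _ [c [s [s0 cx ->]]].
have mB := measurable_euclidean_ball c s.
have abs y : `|\sum_(k <oo) f k y| = \sum_(k <oo) `|f k y|.
  by rewrite gee0_abs ?nneseries_ge0//; apply: eq_eseriesr => k _; rewrite gee0_abs.
rewrite /mean; under eq_integral do rewrite abs.
rewrite integral_nneseries; last 3 first.
- exact: mB.
- by move=> k; apply: measurableT_comp; [exact: abse_measurable|exact: measurable_funTS].
- by move=> k y _; exact: abse_ge0.
apply: le_trans.
  by apply: mule_nneseries_le => [|k]; [exact: inve_mu_ge0|exact: integral_ge0].
apply: lee_nneseries => [k _ _|k _]; first exact: mean_ge0.
by apply: ereal_sup_ubound; exists c, s.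
Qed.

Lemma maximalZ_le f (a : R) x : (0 <= a)%R -> measurable_fun setT f ->
  maximal (fun y => a%:E * f y) x <= a%:E * maximal f x.
Proof.
move=> a0 mf; apply: ge_ereal_sup => _ [c [s [s0 cx ->]]].
have mB := measurable_euclidean_ball c s.
rewrite /mean; under eq_integral do rewrite abseM gee0_abs ?lee_fin//.
rewrite ge0_integralZl; last 4 first.
- exact: mB.
- by apply: measurableT_comp; [exact: abse_measurable|exact: measurable_funTS].
- by move=> y _; exact: abse_ge0.
- by rewrite lee_fin.
rewrite muleCA lee_wpmul2l ?lee_fin//.
by apply: ereal_sup_ubound; exists c, s.
Qed.

End maximal_operator.

(** * Modulars and norms *)

Section modular_facts.
Context {R : realType} {n : nat}.
Local Notation T := (Rn R n).
Local Notation mu := (@leb R n).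
Implicit Types (s : T -> \bar R) (f g : T -> \bar R).

Lemma measurable_divEFin f (l : R) : (0 < l)%R -> measurable_fun setT f ->
  measurable_fun setT (fun x => f x / l%:E).
Proof.
move=> l0 mf; under eq_fun do rewrite divEFin//.
by apply: emeasurable_funM.
Qed.

(** The essential supremum is taken over a null set, and the integral may be
    extended to it. *)
Lemma modular_ae_fin s f : measurable_fun setT s -> measurable_fun setT f ->
  (\forall x \ae mu, s x < +oo) ->
  modular s f = \int[mu]_x (`|f x| `^ fine (s x)).
Proof.
move=> ms mf sfin; rewrite /modular.
pose N : set T := [set x | s x = +oo].
have mN : measurable N.
  by rewrite -[X in measurable X]setTI; apply: measurable_eqe.
have muN : mu N = 0.
  apply: (proj1 (negligibleP _ mN)); apply: negligibleS sfin => x /=.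
  by move=> ->; rewrite ltxx.
rewrite [X in _ + X](_ : _ = 0) ?adde0; last first.
  rewrite unlock; case: ifPn => // muT; apply: abs_ess_sup_eq0 => //.
  apply: filterS sfin => x /= sx _; rewrite patchE; case: ifPn => //.
  by rewrite inE/= => sy; rewrite sy ltxx in sx.
have mfs : measurable_fun setT (fun x => `|f x| `^ fine (s x)).
  by apply: measurable_poweR_fun; [exact: measurableT_comp|exact: measurable_fine_fun].
rewrite [RHS](@ge0_negligible_integral _ _ _ _ setT N).
- congr integral; apply/seteqP; split => x /=; first by move/eqP.
  by move=> [_ /eqP].
- exact: mN.
- exact: measurableT.
- exact: mfs.
- by move=> x _; exact: poweR_ge0.
- exact: muN.
Qed.

(** The infimum defining the norm is approached by some [k < l], and modulars
    decrease when [f] is divided by a larger number. *)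
Lemma modular_var_norm_lt s f (l : R) : exponentP s -> measurable_fun setT f ->
  (\forall x \ae mu, s x < +oo) ->
  var_norm s f < l%:E -> modular s (fun x => f x / l%:E) <= 1.
Proof.
move=> [ms s1] mf sfin /ereal_inf_lt[_ [k [k0 kf] <-]]; rewrite lte_fin => kl.
have l0 := lt_trans k0 kl.
have mp (m : R) : (0 < m)%R ->
    measurable_fun setT (fun x => `|f x / m%:E| `^ fine (s x)).
  move=> m0; apply: measurable_poweR_fun; last exact: measurable_fine_fun.
  by apply: measurableT_comp; [exact: abse_measurable|exact: measurable_divEFin].
apply: le_trans kf; rewrite (modular_ae_fin ms (measurable_divEFin k0 mf) sfin).
rewrite (modular_ae_fin ms (measurable_divEFin l0 mf) sfin).
apply: ge0_le_integral.
- exact: measurableT.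
- by move=> x _; exact: poweR_ge0.
- exact: mp.
- exact: mp.
move=> x _; apply: le_poweR2 => //.
  by rewrite fine_ge0// (le_trans lee01).
rewrite !divEFin// !abseM lee_wpmul2r//= lee_fin !ger0_norm ?invr_ge0 ?ltW//.
by rewrite ltf_pV2 ?posrE.
Qed.

Lemma var_norm_ge0 e f : 0 <= @var_norm R n e f.
Proof. by apply: le_ereal_inf_tmp => _ [l [l0 _] <-]; rewrite lee_fin ltW. Qed.


Lemma modular_gt1 e f (l : R) : (0 < l)%R -> l%:E < @var_norm R n e f ->
  1 < modular e (fun x => f x / l%:E).
Proof.
move=> l0; rewrite !ltNge; apply: contra => m1.
by apply: ereal_inf_lbound; exists l.
Qed.


End modular_facts.

Section norming.
Context {R : realType} {n : nat}.
Local Notation T := (Rn R n).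
Local Notation V := 'rV[R]_n.+1.
Local Notation mu := (@leb R n).
Implicit Types (e u : T -> \bar R).

(** The integrand of the finite part of the modular, extended by [0] to the
    points of infinite exponent: integrals over a subset of the space become
    integrals over the whole space. *)
Definition finite_power e u (x : T) : \bar R :=
  if e x == +oo then 0 else u x `^ fine (e x).

Lemma finite_power_ge0 e u x : 0 <= finite_power e u x.
Proof. by rewrite /finite_power; case: ifP => // _; exact: poweR_ge0. Qed.

Lemma measurable_finite_power e u : measurable_fun setT e ->
  measurable_fun setT u -> measurable_fun setT (finite_power e u).
Proof.
move=> me mu_; apply: measurable_fun_ifT.
- by apply: measurable_fun_eqe; [exact: me|exact: measurable_cst].
- exact: measurable_cst.
- apply: measurable_poweR_fun; first exact: mu_.
  by apply: measurableT_comp => //; exact: fine_measurable.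
Qed.

Lemma integral_finite_power e u : (forall x, 0 <= u x) ->
  \int[mu]_(x in [set x | e x != +oo]) `|u x| `^ fine (e x) =
  \int[mu]_x finite_power e u x.
Proof.
move=> u0; rewrite integral_mkcond; congr integral; apply/funext => x.
rewrite patchE /finite_power; case: (eqVneq (e x) +oo) => ex.
  by rewrite ifF//; apply/negbTE; rewrite notin_setE/= ex eqxx.
by rewrite ifT ?inE//= gee0_abs.
Qed.

Lemma Lnorm_infty_le e u (K : R) : (0 <= K)%R -> (forall x, 0 <= u x) ->
  ('N[mu]_+oo[u \_ [set x | e x = +oo]] <= K%:E) <->
  (\forall x \ae mu, e x = +oo -> u x <= K%:E).
Proof.
move=> K0 u0; rewrite unlock; case: ifPn => muT; last first.
  have {}muT : mu setT = 0.
    by apply/eqP; rewrite eq_le measure_ge0 andbT leNgt.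
  rewrite lee_fin K0; split => // _; exists setT; split => //.
split=> [/ess_supP|h]; last apply/ess_supP.
  by apply: filterS => x /=; rewrite patchE => + ex; rewrite mem_set// gee0_abs.
apply: filterS h => x /=; rewrite patchE; case: ifPn => [|_ _]; last by rewrite abse0 lee_fin.
by rewrite inE/= => ex /(_ ex); rewrite gee0_abs.
Qed.

Lemma modular_le1 e u : measurable_fun setT e -> measurable_fun setT u ->
  (forall x, 0 <= u x) -> modular e u <= 1 ->
  \int[mu]_x finite_power e u x <= 1 /\
  (\forall x \ae mu, e x = +oo -> u x <= 1).
Proof.
move=> me mu_ u0; rewrite /modular integral_finite_power// => m1; split.
  by apply: le_trans m1; rewrite leeDl// Lnorm_ge0.
apply/(Lnorm_infty_le _ _ u0) => //; apply: le_trans m1.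
by rewrite leeDr// integral_ge0// => x _; exact: finite_power_ge0.
Qed.

(** A modular that is merely finite becomes at most [1] on the part of infinite
    exponent after a further division by a bound [K >= 1] of the essential
    supremum; this division does not increase the integral part. *)
Lemma var_Lp_scale e u : exponentP0 e -> (forall x, 0 <= u x) -> var_Lp e u ->
  exists2 L : R, (0 < L)%R &
    \int[mu]_x finite_power e (fun x => u x / L%:E) x < +oo /\
    (\forall x \ae mu, e x = +oo -> u x / L%:E <= 1).
Proof.
move=> [me e0] u0 [mu_ [l l0]].
have ul0 (k : R) : (0 < k)%R -> forall x, 0 <= u x / k%:E.
  by move=> k0 x; rewrite divEFin// mule_ge0// lee_fin invr_ge0 ltW.
rewrite /modular integral_finite_power; last exact: ul0.
set I := \int[mu]_x _ => fin.
have I0 : 0 <= I by apply: integral_ge0 => x _; exact: finite_power_ge0.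
have Ioo : I < +oo by apply: le_lt_trans fin; rewrite leeDl// Lnorm_ge0.
set N := 'N[mu]_+oo[_] in fin.
have N0 : 0 <= N by exact: Lnorm_ge0.
have Noo : N < +oo by apply: le_lt_trans fin; rewrite leeDr.
pose K := (fine N + 1)%R.
have K1 : (1 <= K)%R by rewrite lerDr fine_ge0.
have K0 : (0 < K)%R by exact: lt_le_trans K1.
have NK : N <= K%:E.
  by rewrite -(@fineK _ N) ?ge0_fin_numE// lee_fin lerDl.
exists (l * K)%R; first by rewrite mulr_gt0.
have lK : (0 < l * K)%R by rewrite mulr_gt0.
split.
  apply: le_lt_trans Ioo; apply: ge0_le_integral.
  - exact: measurableT.
  - by move=> x _; exact: finite_power_ge0.
  - by apply: measurable_finite_power; [exact: me|exact: measurable_divEFin].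
  - by apply: measurable_finite_power; [exact: me|exact: measurable_divEFin].
  move=> x _; rewrite /finite_power; case: ifP => // _; apply: le_poweR2.
  - by rewrite fine_ge0// ltW.
  - exact: ul0.
  - rewrite !divEFin// lee_wpmul2r// lee_fin lef_pV2 ?posrE//.
    by rewrite ler_peMr// ltW.
have /(Lnorm_infty_le _ _ (ul0 _ l0)) := NK.
move=> /(_ (ltW K0)); apply: filterS => x + ex => /(_ ex).
rewrite !divEFin// invfM EFinM -muleA [in X in _ -> X]muleCA => h.
by rewrite muleC lee_pdivrMr// mul1e.
Qed.

End norming.

(** * The Rubio de Francia algorithm *)

Section rubio_de_francia.
Context {R : realType} {n : nat}.
Local Notation T := (Rn R n).
Local Notation mu := (@leb R n).
Variables (s : T -> \bar R).
Hypothesis sB : maximal_bounded s.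
Hypothesis sfin : \forall x \ae mu, s x < +oo.

Let sigma x := fine (s x).

Let s_exp : exponentP s. Proof. by case: sB. Qed.

Let msigma : measurable_fun setT sigma.
Proof.
by apply: measurableT_comp; [exact: fine_measurable|case: s_exp].
Qed.

Let sigma_ge0 x : (0 <= sigma x)%R.
Proof. by rewrite fine_ge0// (le_trans lee01)//; case: s_exp. Qed.

Let sigma_ge1 x : s x < +oo -> (1 <= sigma x)%R.
Proof.
move=> sx; have s1 := s_exp.2 x.
by rewrite -lee_fin fineK// ge0_fin_numE// (le_trans lee01).
Qed.

Let m_pow (f : T -> \bar R) : measurable_fun setT f ->
  measurable_fun setT (fun x => f x `^ sigma x).
Proof. by move=> mf; exact: measurable_poweR_fun. Qed.

(** The functions [g j] are the iterates [M ^ j G / D ^ j], with [D] strictly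
    larger than the bound of [M] on the space. The strict inequality makes the
    norm of [M ^ j.+1 G] strictly less than [D ^ j.+1] once that of [M ^ j G] is
    at most [D ^ j], and a norm less than [l] yields a modular at most [1] after
    division by [l]. *)
Lemma iter_maximal_modular (G : T -> \bar R) :
  measurable_fun setT G -> (forall x, 0 <= G x) -> modular s G <= 1 ->
  exists2 D : R, (0 < D)%R & exists g : nat -> T -> \bar R,
  [/\ g 0%N = G,
      forall j, measurable_fun setT (g j) /\ (forall x, 0 <= g j x),
      forall j x, maximal (g j) x <= D%:E * g j.+1 x &
      forall j, \int[mu]_x (g j x `^ sigma x) <= 1].
Proof.
move=> mG G0 modG; have [_ [C MC]] := sB.
pose D := (`|C| + 1)%R.
have D0 : (0 < D)%R by rewrite ltr_wpDl.
have DX0 j : (0 < D ^+ j)%R by rewrite exprn_gt0.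
pose M j : T -> \bar R := iter j maximal G.
have mM j : measurable_fun setT (M j).
  by case: j => [|j]; [exact: mG|exact: maximal_measurable].
have M0 j x : 0 <= M j x by case: j => // j; exact: maximal_ge0.
have modM j : modular s (fun x => M j x / (D ^+ j)%:E) <= 1.
  elim: j => [|j IH].
    rewrite expr0 (_ : (fun x => _) = G)//; apply/funext => x.
    by rewrite inve1 mule1.
  apply: modular_var_norm_lt => //.
  have MLp : var_Lp s (M j).
    by split=> //; exists (D ^+ j)%R => //; rewrite (le_lt_trans IH)// ltry.
  apply: (le_lt_trans (MC _ MLp)).
  have nj : var_norm s (M j) <= (D ^+ j)%:E.
    by apply: ereal_inf_lbound; exists (D ^+ j)%R.
  have n0 : 0 <= var_norm s (M j).
    by apply: le_ereal_inf_tmp => _ [l [l0 _] <-]; rewrite lee_fin ltW.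
  apply: (@le_lt_trans _ _ (`|C|%:E * (D ^+ j)%:E)).
    apply: (@le_trans _ _ (`|C|%:E * var_norm s (M j))).
      by rewrite lee_wpmul2r// lee_fin ler_norm.
    by rewrite lee_wpmul2l// lee_fin.
  by rewrite -EFinM lte_fin exprS ltr_pM2r// ltrDl.
exists D => //; exists (fun j x => ((D ^+ j)^-1)%:E * M j x); split.
- by apply/funext => x; rewrite expr0 invr1 mul1e.
- move=> j; split=> [|x]; first exact: emeasurable_funM.
  by rewrite mule_ge0// lee_fin invr_ge0 ltW.
- move=> j x; apply: le_trans.
    by apply: maximalZ_le => //; rewrite invr_ge0 ltW.
  rewrite muleA -EFinM exprS invfM mulrA divff ?gt_eqF// mul1r.
  exact: lexx.
- move=> j; apply: le_trans (modM j).
  rewrite (modular_ae_fin _ _ sfin); last 2 first.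
  - by case: s_exp.
  - by apply: measurable_divEFin; [exact: DX0|exact: mM].
  rewrite le_eqVlt; apply/orP; left; apply/eqP; apply: eq_integral => x _.
  by rewrite divEFin// gee0_abs// mule_ge0// lee_fin invr_ge0 ltW.
Qed.

(** Local integrability comes from [v <= 1 + v ^ s], valid wherever [1 <= s]. *)
Lemma weight_of_power (v : T -> R) : measurable_fun setT v ->
  (forall x, (0 <= v x)%R) ->
  \int[mu]_x ((v x)%:E `^ fine (s x)) < +oo -> weight v.
Proof.
move=> mv v0 intv; split=> // K cK.
have mEv : measurable_fun setT (fun x => (v x)%:E) by exact: measurable_EFin_fun.
have mK := compact_measurable_Rn cK.
apply: (@le_lt_trans _ _ (\int[mu]_(x in K) (cst 1 x + (v x)%:E `^ sigma x))).
  apply: ae_ge0_le_integral.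
  - exact: mK.
  - by move=> x _; rewrite lee_fin.
  - exact: measurable_funTS.
  - by move=> x _; apply: adde_ge0; [exact: lee01|exact: poweR_ge0].
  - apply: measurable_funTS; apply: emeasurable_funD.
      exact: measurable_cst.
    exact: m_pow.
  apply: filterS sfin => x /sigma_ge1 s1 _ /=.
  have [v1|v1] := leP (v x) 1%R.
    apply: (@le_trans _ _ 1); first by rewrite lee_fin.
    by apply: leeDl; rewrite lee_fin powR_ge0.
  apply: (@le_trans _ _ ((v x)%:E `^ sigma x)); last by apply: leeDr; exact: lee01.
  by rewrite poweR_EFin lee_fin; apply: le1r_powR => //; exact: ltW.
rewrite ge0_integralD; last 5 first.
- exact: mK.
- by move=> x _; exact: lee01.
- exact: measurable_cst.
- by move=> x _; exact: poweR_ge0.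
- by apply: measurable_funTS; exact: m_pow.
rewrite integral_cst// mul1e lte_add_pinfty//.
  have [k Kk] := compact_cube cK.
  apply: (@le_lt_trans _ _ (mu (cube 0%R k%:R))); last exact: leb_cube_fin.
  by apply: le_measure => //; rewrite inE//; exact: measurable_cube.
apply: le_lt_trans intv; apply: ge0_subset_integral.
- exact: mK.
- exact: measurableT.
- exact: m_pow.
- by move=> x _; exact: poweR_ge0.
- exact: subsetT.
Qed.

(** The coefficients [1 / 2 * 4 ^- j] of the weight, written so that
    [poweR_nneseries_le] applies; their ratio [4] enters the [A_1] bound. *)
Let coef (j : nat) : R := (2 ^- j.+1 * 2 ^- j)%R.

Let coef_ge0 j : (0 <= coef j)%R. Proof. by rewrite mulr_ge0. Qed.

Let coefS j : (coef j = 4 * coef j.+1)%R.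
Proof.
rewrite /coef !exprS; have : (2 ^+ j != 0 :> R)%R by rewrite expf_neq0.
by move: (2 ^+ j)%R => t t0; field.
Qed.

(** The weight is [V = \sum_j coef j * g j]: its first term is [G / 2], the
    operator [M] shifts the series, so that [M V <= 4 D V], and the [s]-th power
    of [V] is dominated termwise. It is finite almost everywhere because its
    [s]-th power is integrable; [fine] changes it on a null set only. *)
Lemma rubio_de_francia (G : T -> \bar R) :
  measurable_fun setT G -> (forall x, 0 <= G x) -> modular s G <= 1 ->
  exists v : T -> R, [/\ A1 v,
    \forall x \ae mu, 2^-1%:E * G x <= (v x)%:E &
    \int[mu]_x ((v x)%:E `^ fine (s x)) <= 2%:E].
Proof.
move=> mG G0 modG.
have [D D0 [g [g0G mg0 Mg intg]]] := iter_maximal_modular mG G0 modG.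
have mg j : measurable_fun setT (g j) by case: (mg0 j).
have g0 j x : 0 <= g j x by case: (mg0 j).
have mcg j : measurable_fun setT (fun x => (coef j)%:E * g j x).
  exact: emeasurable_funM.
have cg0 j x : 0 <= (coef j)%:E * g j x by rewrite mule_ge0// lee_fin.
pose V x := \sum_(j <oo) (coef j)%:E * g j x.
have mV : measurable_fun setT V.
  by apply: ge0_emeasurable_sum.
have V0 x : 0 <= V x by exact: nneseries_ge0.
have MV x : maximal V x <= (4 * D)%:E * V x.
  apply: le_trans; first exact: maximal_nneseries.
  apply: (@le_trans _ _ (\sum_(j <oo) (4 * D)%:E * ((coef j.+1)%:E * g j.+1 x))).
    apply: lee_nneseries => [j _ _|j _]; first exact: maximal_ge0.
    apply: le_trans; first exact: maximalZ_le.
    apply: (@le_trans _ _ ((coef j)%:E * (D%:E * g j.+1 x))).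
      by rewrite lee_wpmul2l// lee_fin.
    by rewrite !muleA -!EFinM coefS mulrAC.
  rewrite nneseriesZl// lee_wpmul2l//; first by rewrite lee_fin mulr_ge0// ltW.
  rewrite /V [leRHS]nneseries_recl//.
  under eq_eseriesr do rewrite -addn1.
  rewrite (@nneseries_addn _ (fun j => (coef j)%:E * g j x) 1)//.
  by rewrite leeDr.
have mpg j : measurable_fun setT (fun x => (2 ^- j)%:E * g j x `^ sigma x).
  by apply: emeasurable_funM; [exact: measurable_cst|exact: m_pow].
have pg0 j x : 0 <= (2 ^- j)%:E * g j x `^ sigma x.
  by rewrite mule_ge0 ?poweR_ge0// lee_fin.
pose B x := \sum_(j <oo) (2 ^- j)%:E * g j x `^ sigma x.
have mB : measurable_fun setT B by apply: ge0_emeasurable_sum.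
have B0 x : 0 <= B x by exact: nneseries_ge0.
have intB : \int[mu]_x B x <= 2%:E.
  rewrite integral_nneseries//.
  apply: (@le_trans _ _ (\sum_(j <oo) (2 ^- j.+1)%:E * 2%:E)); last first.
    by apply: nneseries_half_le; rewrite lee_fin.
  apply: lee_nneseries => [j _ _|j _]; first exact: integral_ge0.
  rewrite ge0_integralZl; last 4 first.
  - exact: measurableT.
  - exact: m_pow.
  - by move=> x _; exact: poweR_ge0.
  - by rewrite lee_fin.
  rewrite -EFinM exprS invfM mulrAC mulVf// mul1r -[leRHS]mule1.
  by rewrite lee_wpmul2l// lee_fin.
have VB : \forall x \ae mu, V x `^ sigma x <= B x.
  by apply: filterS sfin => x sx; apply: poweR_nneseries_le => //; exact: sigma_ge1.
have intV : \int[mu]_x (V x `^ sigma x) <= 2%:E.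
  apply: le_trans intB; apply: ae_ge0_le_integral.
  - exact: measurableT.
  - by move=> x _; exact: poweR_ge0.
  - exact: m_pow.
  - by move=> x _; exact: B0.
  - exact: mB.
  - by apply: filterS VB => x + _.
have Vfin : \forall x \ae mu, V x < +oo.
  have Vi : mu.-integrable setT (fun x => V x `^ sigma x).
    apply/integrableP; split; first exact: m_pow.
    under eq_integral do rewrite gee0_abs ?poweR_ge0//.
    by rewrite (le_lt_trans intV)// ltry.
  have := integrable_ae measurableT Vi; apply: filterS2 sfin => x sx /(_ I).
  rewrite ge0_fin_numE ?poweR_ge0//; apply: lty_poweRy.
  rewrite gt_eqF// /sigma fine_gt0// sx andbT (lt_le_trans lte01)//.
  by rewrite s_exp.2.
pose v x := fine (V x).
have v0 x : (0 <= v x)%R by exact: fine_ge0.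
have mv : measurable_fun setT v.
  by apply: measurableT_comp => //; exact: fine_measurable.
have vV x : (v x)%:E <= V x.
  by rewrite /v; case: (V x) (V0 x) => //= _; rewrite leey.
have Vv : \forall x \ae mu, V x = (v x)%:E.
  by apply: filterS Vfin => x Vx; rewrite /v fineK// ge0_fin_numE.
have mEv : measurable_fun setT (EFin \o v) by exact/measurable_EFinP.
have intv : \int[mu]_x ((v x)%:E `^ sigma x) <= 2%:E.
  apply: le_trans intV; apply: ge0_le_integral.
  - exact: measurableT.
  - by move=> x _; exact: poweR_ge0.
  - exact: m_pow.
  - exact: m_pow.
  - by move=> x _; apply: le_poweR2 => //; rewrite lee_fin.
exists v; split; last exact: intv.
- split.
    by apply: weight_of_power => //; rewrite (le_lt_trans intv)// ltry.
  exists (4 * D)%R; apply: filterS Vv => x <-.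
  apply: le_trans (MV x).
  by apply: le_maximal => // y; rewrite lee_fin.
- apply: filterS Vv => x <-.
  rewrite /V nneseries_recl// g0G /coef expr1 expr0 invr1 mulr1 leeDl//.
  by apply: nneseries_ge0 => j _ _; exact: cg0.
Qed.

End rubio_de_francia.

(** * Norming densities *)

Section norming_density.
Context {R : realType} {n : nat}.
Local Notation T := (Rn R n).
Local Notation mu := (@leb R n).
Implicit Types (e u : T -> \bar R).

(** The normalised indicator of a piece of [E] of finite positive measure. *)
Lemma norming_density_set (E : set T) : measurable E -> 0 < mu E ->
  exists phi : T -> \bar R, [/\ measurable_fun setT phi, forall x, 0 <= phi x,
    \int[mu]_x phi x = 1 & forall x, phi x != 0 -> E x].
Proof.
move=> mE /(positive_measure_in_cube mE)[k Ek].
set A : set T := E `&` _ in Ek.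
have mA : measurable A by apply: measurableI; [exact: mE|exact: measurable_cube].
have Aoo : mu A < +oo.
  apply: (@le_lt_trans _ _ (mu (cube 0%R k%:R))); last exact: leb_cube_fin.
  apply: le_measure; last exact: subIsetr.
    by rewrite inE.
  by rewrite inE; exact: measurable_cube.
have fA0 : (0 < fine (mu A))%R by rewrite fine_gt0// Ek Aoo.
have mI : measurable_fun setT (fun x : T => (\1_A x)%:E : \bar R).
  by apply/measurable_EFinP; exact: measurable_indic.
exists (fun x => ((fine (mu A))^-1)%:E * (\1_A x)%:E); split.
- exact: emeasurable_funM.
- by move=> x; rewrite mule_ge0// lee_fin// invr_ge0 ltW.
- rewrite ge0_integralZl; last 4 first.
  + exact: measurableT.
  + exact: mI.
  + by move=> x _; rewrite lee_fin.
  + by rewrite lee_fin invr_ge0 ltW.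
  rewrite (_ : \int[mu]_x _ = (fine (mu A))%:E).
    by rewrite -EFinM mulVf// gt_eqF.
  by rewrite integral_indic// setIT fineK// ge0_fin_numE.
- move=> x; rewrite indicE; have [|_] := boolP (x \in A).
    by rewrite inE => -[].
  by rewrite mule0 eqxx.
Qed.

(** If [u] is infinite, or exceeds [1 / 2] at points of infinite exponent, on a
    set of positive measure, the mass is put on that set: there either [u = +oo],
    or the exponent of [phi] on the right is [1] and [2 * u >= 1]. Otherwise the
    integral part [F = u ^ e] of the modular exceeds [1 / 2] and [F] is almost
    everywhere finite. Then [phi] is the restriction of [F] to a set of finite
    integral, normalised when its mass exceeds [1]; as
    [phi <= F], one has [phi ^ (r / e) <= u ^ r], and the claim is
    [phi = phi ^ (r / e) * phi ^ (1 - r / e)]. *)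
Lemma norming_density e u (r : R) : exponentP0 e -> measurable_fun setT u ->
  (forall x, 0 <= u x) -> (0 < r)%R -> 1 < modular e u ->
  exists phi : T -> \bar R, [/\ measurable_fun setT phi, forall x, 0 <= phi x,
    \int[mu]_x phi x <= 1, (2^-1)%:E <= \int[mu]_x phi x &
    forall x, phi x <= (2 `^ r)%:E * (u x `^ r * phi x `^ (1 - r * (fine (e x))^-1))].
Proof.
move=> [me e0] mu_ u0 r0 m1.
have h2 : (2^-1 <= 1 :> R)%R by rewrite invf_le1// ler1n.
pose E : set T := [set x | u x = +oo] `|` ([set x | e x = +oo] `&` [set x | (2^-1)%:E < u x]).
have mE : measurable E.
  apply: measurableU; first by rewrite -[X in measurable X]setTI; apply: measurable_eqe.
  apply: measurableI; first by rewrite -[X in measurable X]setTI; apply: measurable_eqe.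
  by rewrite -[X in measurable X]setTI; exact: emeasurable_fun_o_infty.
have [muE|] := ltP 0 (mu E).
  have [phi [mphi phi0 iphi phiE]] := norming_density_set mE muE.
  exists phi; split => //; first by rewrite iphi.
    by rewrite iphi lee_fin.
  move=> x; have [->|px] := eqVneq (phi x) 0.
    by rewrite mule_ge0 ?lee_fin ?powR_ge0// mule_ge0// poweR_ge0.
  have px0 : 0 < phi x by rewrite lt0e px phi0.
  case: (phiE _ px) => [/= ux|[/= ex ux]].
    by rewrite ux poweRyr ?gt_eqF// gt0_mulye ?poweR_gt0// gt0_muley ?leey//.
  rewrite ex /= invr0 mulr0 subr0 poweRe1// muleA -[leLHS]mul1e lee_wpmul2r//.
  rewrite -(poweR_EFin 2) -poweRM//.
  rewrite -(poweR1r r); apply: le_poweR2 => //; first exact: ltW.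
  rewrite (_ : 1 = 2%:E * (2^-1)%:E); last by rewrite -EFinM divff.
  by rewrite lee_wpmul2l ?lee_fin// ltW.
rewrite measure_le0 => /eqP muE0.
have aeE : \forall x \ae mu, ~ E x.
  by exists E; split => // x /=; rewrite notK.
have N2 : 'N[mu]_+oo[u \_ [set x | e x = +oo]] <= (2^-1)%:E.
  apply/Lnorm_infty_le => //; apply: filterS aeE => x /= nE ex.
  by rewrite leNgt; apply/negP => ux; apply: nE; right.
pose F := finite_power e u.
have mF : measurable_fun setT F by exact: measurable_finite_power.
have F0 x : 0 <= F x by exact: finite_power_ge0.
have intF : (2^-1)%:E < \int[mu]_x F x.
  rewrite ltNge; apply/negP => iF; move: m1; rewrite /modular integral_finite_power//.
  apply/negP; rewrite -leNgt (_ : 1 = (2^-1)%:E + (2^-1)%:E); last first.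
    by rewrite -EFinD; congr (_%:E); lra.
  exact: leeD.
(* The integral of [F] over [S k] is finite, and it increases to that of [F]. *)
pose S (k : nat) : set T := cube 0%R k%:R `&` [set x | F x <= k%:R%:E].
have mS k : measurable (S k).
  apply: measurableI; first exact: measurable_cube.
  by rewrite -[X in measurable X]setTI; exact: emeasurable_fun_infty_c.
have ndS : nondecreasing_seq S.
  move=> i j ij; apply/subsetPset => x [cx Fx]; split => [k|/=].
    by apply: lt_le_trans (cx k) _; rewrite ler_nat.
  by apply: le_trans Fx _; rewrite lee_fin ler_nat.
have US : \bigcup_k S k = [set x | F x < +oo].
  apply/seteqP; split=> [x [k _ [_ /= Fx]]|x /= Fx].
    by rewrite (le_lt_trans Fx)// ltry.
  have [k xk] := cube_exhausts x.
  exists (maxn k (Num.bound (fine (F x)))) => //; split => [i|/=].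
    by apply: lt_le_trans (xk i) _; rewrite ler_nat leq_maxl.
  rewrite -[F x]fineK ?ge0_fin_numE// lee_fin.
  rewrite (@le_trans _ _ (Num.bound (fine (F x)))%:R)//.
    by rewrite ltW// archi_boundP// fine_ge0.
  by rewrite ler_nat leq_maxr.
have : exists k, (2^-1)%:E < \int[mu]_(x in S k) F x.
  apply: contrapT => /forallNP h; move: intF; apply/negP; rewrite -leNgt.
  pose N : set T := [set x | F x = +oo].
  have mN : measurable N by rewrite -[X in measurable X]setTI; apply: measurable_eqe.
  rewrite (@ge0_negligible_integral _ _ _ mu setT N)//; last first.
    apply: (proj1 (negligibleP _ mN)); apply: negligibleS (proj2 (negligibleP _ mE) muE0).
    by move=> x; rewrite /N/= /F /finite_power; case: ifP => // _ /poweR_eqy ux; left.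
  rewrite (_ : setT `\` N = \bigcup_k S k); last first.
    rewrite US; apply/seteqP; split => x /=.
      by move=> [_ /eqP]; rewrite ltey.
    by move=> Fx; split => // Fy; rewrite Fy ltxx in Fx.
  have cv := @ge0_nondecreasing_set_cvg_integral _ T R S F mu ndS mS
    (fun k => measurable_funTS mF) (fun k x _ => F0 x).
  rewrite -(cvg_lim _ cv)//; apply: lime_le; first exact: cvgP cv.
  by apply: nearW => k; rewrite leNgt; exact/negP/h.
move=> [k Sk]; set c := \int[mu]_(x in S k) F x in Sk.
have coo : c < +oo.
  apply: (@le_lt_trans _ _ (k%:R%:E * mu (S k))).
    rewrite -integral_cst//; apply: ge0_le_integral.
    - exact: mS.
    - by move=> x _; exact: F0.
    - exact: measurable_funTS.
    - exact: measurable_cst.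
    - by move=> x [].
  rewrite lte_mul_pinfty ?lee_fin//.
  apply: (@le_lt_trans _ _ (mu (cube 0%R k%:R))); last exact: leb_cube_fin.
  apply: le_measure; last exact: subIsetl.
    by rewrite inE.
  by rewrite inE; exact: measurable_cube.
have c0 : 0 <= c by rewrite ltW// (lt_trans _ Sk)// lte_fin.
pose M := Num.max 1%R (fine c).
have M1 : (1 <= M)%R by rewrite le_max lexx.
have M0 : (0 < M)%R by exact: lt_le_trans M1.
have cM : c <= M%:E by rewrite -[c]fineK ?ge0_fin_numE// lee_fin le_max lexx orbT.
pose phi x := (M^-1)%:E * (F \_ (S k)) x.
have mFS : measurable_fun setT (F \_ (S k)).
  by apply/(measurable_restrictT F (mS k)); exact: measurable_funTS.
have FS0 x : 0 <= (F \_ (S k)) x by rewrite patchE; case: ifP.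
have iphi : \int[mu]_x phi x = (M^-1)%:E * c.
  rewrite ge0_integralZl//; last by rewrite lee_fin invr_ge0 ltW.
  by rewrite -integral_mkcond.
have phi0 x : 0 <= phi x by rewrite mule_ge0// lee_fin invr_ge0 ltW.
exists phi; split => //.
- exact: emeasurable_funM.
- by rewrite iphi lee_pdivrMl// mule1.
- rewrite iphi /M /Num.max; case: ifP => [c1|_].
    rewrite (_ : (_ * c)%E = ((fine c)^-1)%:E * (fine c)%:E); last first.
      by rewrite fineK// ge0_fin_numE.
    by rewrite -EFinM mulVf ?lee_fin// gt_eqF// (lt_trans _ c1).
  by rewrite invr1 mul1e ltW.
move=> x; have [->|px] := eqVneq (phi x) 0.
  by rewrite mule_ge0 ?lee_fin ?powR_ge0// mule_ge0// poweR_ge0.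
have phiF : phi x <= F x.
  rewrite /phi patchE; case: ifP => _; last by rewrite mule0.
  rewrite -[leRHS]mul1e lee_wpmul2r// lee_fin invf_le1//.
have ex : e x != +oo.
  apply/eqP => ex; move: px; rewrite /phi patchE.
  by rewrite /F /finite_power ex eqxx/=; case: ifP; rewrite mule0 eqxx.
have fe0 : (0 < fine (e x))%R by rewrite fine_gt0// e0 ltey.
rewrite -[leLHS](poweRe1 (phi0 x)) -[X in phi x `^ X](subrKC (r * (fine (e x))^-1)).
rewrite poweRD; last first.
  by apply: add_neq0_poweRD_def; rewrite subrKC oner_neq0.
rewrite muleA lee_wpmul2r ?poweR_ge0//.
apply: (@le_trans _ _ (F x `^ (r * (fine (e x))^-1))).
  by apply: le_poweR2 => //; rewrite divr_ge0// ltW.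
rewrite /F /finite_power (negbTE ex) -poweRrM mulrCA divff ?gt_eqF// mulr1.
rewrite -[leLHS]mul1e lee_wpmul2r ?poweR_ge0// lee_fin.
rewrite -[leLHS](powRr0 2); apply: ler_powR; [by rewrite ler1n|exact: ltW].
Qed.

End norming_density.

(** * Duality between exponents *)

Section exponents.
Context {R : realType}.
Implicit Types (a : \bar R).

Lemma fine_inve a : 0 < a -> fine a^-1 = (fine a)^-1%R.
Proof.
case: a => [a a0||//]; last by rewrite invey/= invr0.
by rewrite inver gt_eqF.
Qed.

(** With the convention [fine +oo = 0], the identity between extended reals
    becomes an identity between reals that covers infinite exponents. *)
Lemma fine_inveD a b c : 0 < a -> 0 < b -> 0 < c -> a^-1 = b^-1 + c^-1 ->
  ((fine a)^-1 = (fine b)^-1 + (fine c)^-1)%R.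
Proof.
move=> a0 b0 c0 abc; rewrite -!fine_inve// abc fineD//.
  by case: b b0 {abc} => [b b0||//]; rewrite ?inver ?gt_eqF// invey.
by case: c c0 {abc} => [c c0||//]; rewrite ?inver ?gt_eqF// invey.
Qed.

Lemma hoelder_conjugate_fine (p : R) a : (0 < p)%R -> p%:E < a ->
  let s := hoelder_conjugate (a / p%:E) in
  s < +oo /\ (p * (fine a)^-1 + (fine s)^-1 = 1)%R.
Proof.
move=> p0; case: a => [a pa||//].
  have {}pa : (p < a)%R by rewrite -lte_fin.
  have a0 : (0 < a)%R by exact: lt_trans pa.
  rewrite (_ : a%:E / p%:E = (a / p)%:E); last by rewrite inver gt_eqF.
  have ap : (0 < a / p - 1)%R by rewrite subr_gt0 ltr_pdivlMr// mul1r.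
  rewrite /hoelder_conjugate /= eqe gt_eqF ?divr_gt0// -EFinD inver gt_eqF//=.
  rewrite -EFinM ltry/=; split=> //.
  have ap' : (a - p != 0)%R by rewrite subr_eq0 gt_eqF.
  field.
  by rewrite mulN1r ap' !gt_eqF.
move=> _ /=; rewrite divEFin// gt0_muley ?lte_fin ?invr_gt0// hoelder_conjugatey.
by rewrite ltry/= invr0 mulr0 add0r invr1.
Qed.

Lemma sum_scaled_exponents (p q r : R) : (0 < p)%R -> (0 < q)%R -> (0 < r)%R ->
  (r^-1 = p^-1 + q^-1)%R -> (r / p + r / q = 1)%R.
Proof. by move=> p0 q0 r0 rpq; rewrite -mulrDr -rpq divff// gt_eqF. Qed.


End exponents.

Section pairing.
Context {R : realType} {n : nat}.
Local Notation T := (Rn R n).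
Local Notation mu := (@leb R n).
Implicit Types (e s t : T -> \bar R).

(** Young's inequality [u ^ p * v <= u ^ e + v ^ s] for [u = f / l], integrated:
    the modulars of [u] and [v] are at most [1] and [2], hence the [3]. *)
Lemma integral_pairing_le e s (p l : R) (f : T -> \bar R) (v : T -> R) :
  (0 < p)%R -> (0 < l)%R -> exponentP0 e -> measurable_fun setT s ->
  (\forall x \ae mu, [/\ 0 < s x, s x < +oo &
     (p * (fine (e x))^-1 + (fine (s x))^-1 = 1)%R]) ->
  nonneg_measurable f -> measurable_fun setT v -> (forall x, 0 <= v x)%R ->
  \int[mu]_x ((v x)%:E `^ fine (s x)) <= 2%:E ->
  modular e (fun x => f x / l%:E) <= 1 ->
  \int[mu]_x (f x `^ p * (v x)%:E) <= (l `^ p)%:E * 3%:E.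
Proof.
move=> p0 l0 [me e0] ms es [mf f0] mv v0 intv modf.
pose u x := f x / l%:E.
have mu_ : measurable_fun setT u by exact: measurable_divEFin.
have u0 x : 0 <= u x by rewrite /u divEFin// mule_ge0// lee_fin invr_ge0 ltW.
have fu x : f x `^ p * (v x)%:E = (l `^ p)%:E * (u x `^ p * (v x)%:E).
  rewrite muleA; congr (_ * _).
  rewrite -poweR_EFin -poweRM ?lee_fin//; last exact: ltW.
  by rewrite /u divEFin// muleA -EFinM divff ?mul1e// gt_eqF.
have muv : measurable_fun setT (fun x => u x `^ p * (v x)%:E).
  by apply: emeasurable_funM; [exact: measurable_poweR_cst|exact: measurable_EFin_fun].
have mvs : measurable_fun setT (fun x => (v x)%:E `^ fine (s x)).
  by apply: measurable_poweR_fun; [exact: measurable_EFin_fun|exact: measurable_fine_fun].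
under eq_integral do rewrite fu.
rewrite ge0_integralZl; last 4 first.
- exact: measurableT.
- exact: muv.
- by move=> x _; apply: mule_ge0; [exact: poweR_ge0|rewrite lee_fin].
- by rewrite lee_fin powR_ge0.
apply: lee_wpmul2l; first by rewrite lee_fin powR_ge0.
have [iF u1] := modular_le1 me mu_ u0 modf.
have mF := measurable_finite_power me mu_.
apply: (@le_trans _ _ (\int[mu]_x (finite_power e u x + (v x)%:E `^ fine (s x)))).
  apply: ae_ge0_le_integral.
  - exact: measurableT.
  - by move=> x _; apply: mule_ge0; [exact: poweR_ge0|rewrite lee_fin].
  - exact: muv.
  - by move=> x _; apply: adde_ge0; [exact: finite_power_ge0|exact: poweR_ge0].
  - exact: emeasurable_funD.
  apply: filterS2 es u1 => x [s0 soo ps] u1 _.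
  set m := (X in _ <= X).
  have F0 := finite_power_ge0 e u x.
  have V0 := poweR_ge0 (v x)%:E (fine (s x)).
  have m0 : 0 <= m by exact: adde_ge0.
  rewrite -(poweR_prod2 (a := p * (fine (e x))^-1) (b := (fine (s x))^-1) _ _ ps m0).
  - apply: lee_pmul; [exact: poweR_ge0|by rewrite lee_fin|..].
      apply: le_poweR_exponent => //; first exact: ltW.
      move=> ex; rewrite (@le_trans _ _ (finite_power e u x))//.
        by rewrite /finite_power (negbTE ex).
      exact: leeDl.
    rewrite -[leLHS]poweRe1 ?lee_fin// -[X in _ <= _ `^ X]mul1r.
    apply: le_poweR_exponent => //; first by rewrite lee_fin.
      by move=> sy; rewrite sy ltxx in soo.
    by move=> _; exact: leeDr.
  - by apply: divr_ge0; [exact: ltW|apply: fine_ge0; exact: ltW].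
  - by rewrite invr_ge0; apply: fine_ge0; exact: ltW.
rewrite ge0_integralD; last 5 first.
- exact: measurableT.
- by move=> x _; exact: finite_power_ge0.
- exact: mF.
- by move=> x _; exact: poweR_ge0.
- exact: mvs.
have -> : (3 = 1 + 2 :> R)%R by lra.
by rewrite EFinD; exact: leeD.
Qed.

Lemma pairing_var_norm_le e s (p : R) (f : T -> \bar R) (v : T -> R) :
  (0 < p)%R -> exponentP0 e -> measurable_fun setT s ->
  (\forall x \ae mu, [/\ 0 < s x, s x < +oo &
     (p * (fine (e x))^-1 + (fine (s x))^-1 = 1)%R]) ->
  nonneg_measurable f -> measurable_fun setT v -> (forall x, 0 <= v x)%R ->
  \int[mu]_x ((v x)%:E `^ fine (s x)) <= 2%:E ->
  (\int[mu]_x (f x `^ p * (v x)%:E)) `^ p^-1 <= (3 `^ p^-1)%:E * var_norm e f.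
Proof.
move=> p0 eP ms es fP mv v0 intv.
have c0 : (0 < 3 `^ p^-1 :> R)%R by rewrite powR_gt0.
rewrite -lee_pdivrMl//; apply: le_ereal_inf_tmp => _ [l [l0 modl] <-].
rewrite lee_pdivrMl//.
have := integral_pairing_le p0 l0 eP ms es fP mv v0 intv modl.
move=> /(@le_poweR2 _ p^-1); rewrite invr_ge0 => /(_ (ltW p0)) h.
apply: le_trans; first apply: h.
  apply: integral_ge0 => x _; apply: mule_ge0; [exact: poweR_ge0|by rewrite lee_fin].
rewrite -EFinM poweR_EFin -EFinM lee_fin powRM ?powR_ge0//.
by rewrite -powRrM divff ?gt_eqF// powRr1 1?mulrC//; exact: ltW.
Qed.

End pairing.

Section bilinear.
Context {R : realType} {n : nat}.
Local Notation T := (Rn R n).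
Local Notation mu := (@leb R n).
Variables (rv s t : T -> \bar R) (a b r : R).
Hypotheses (a0 : (0 < a)%R) (b0 : (0 < b)%R) (ab : (a + b = 1)%R) (r0 : (0 < r)%R).
Hypothesis rv_exp : exponentP0 rv.
Hypotheses (ms : measurable_fun setT s) (mt : measurable_fun setT t).
Hypothesis dual : \forall x \ae mu,
  [/\ 0 < s x < +oo, 0 < t x < +oo &
     (r * (fine (rv x))^-1 + a * (fine (s x))^-1 + b * (fine (t x))^-1 = 1)%R].
Variables (v w : T -> R).
Hypotheses (mv : measurable_fun setT v) (mw : measurable_fun setT w).
Hypotheses (v0 : forall x, (0 <= v x)%R) (w0 : forall x, (0 <= w x)%R).

Let pair (h : T -> \bar R) x := h x `^ r * (v x)%:E `^ a * (w x)%:E `^ b.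

Let m_pair h : measurable_fun setT h -> measurable_fun setT (pair h).
Proof.
move=> mh; apply: emeasurable_funM; last by apply: measurable_poweR_cst; exact: measurable_EFin_fun.
apply: emeasurable_funM; first exact: measurable_poweR_cst.
by apply: measurable_poweR_cst; exact: measurable_EFin_fun.
Qed.

Let pair_ge0 h x : 0 <= pair h x.
Proof.
apply: mule_ge0; last exact: poweR_ge0.
by apply: mule_ge0; exact: poweR_ge0.
Qed.

Let pairZ (l : R) h x : (0 < l)%R -> 0 <= h x ->
  pair h x = (l `^ r)%:E * pair (fun x => h x / l%:E) x.
Proof.
move=> l0 h0; rewrite /pair !muleA; congr (_ * _ * _).
rewrite -poweR_EFin -poweRM; last 2 first.
- by rewrite lee_fin ltW.
- by rewrite divEFin// mule_ge0// lee_fin invr_ge0 ltW.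
by rewrite divEFin// muleA -EFinM divff ?mul1e// gt_eqF.
Qed.

(** The three-factor inequality of Young for [u = h / l], where [l] is large
    enough for [u] to be at most [1] at points of infinite exponent. *)
Lemma bilinear_integral_lty h : nonneg_measurable h -> var_Lp rv h ->
  \int[mu]_x ((v x)%:E `^ fine (s x)) <= 2%:E ->
  \int[mu]_x ((w x)%:E `^ fine (t x)) <= 2%:E ->
  \int[mu]_x (h x `^ r * (v x)%:E `^ a * (w x)%:E `^ b) < +oo.
Proof.
move=> [mh h0] hLp iv iw; have [l l0 [iF u1]] := var_Lp_scale rv_exp h0 hLp.
pose u x := h x / l%:E.
have mu_ : measurable_fun setT u by exact: measurable_divEFin.
have u0 x : 0 <= u x by rewrite /u divEFin// mule_ge0// lee_fin invr_ge0 ltW.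
rewrite (eq_integral (fun x => (l `^ r)%:E * pair u x)); last first.
  by move=> x _; rewrite -pairZ.
rewrite ge0_integralZl; last 4 first.
- exact: measurableT.
- exact: m_pair.
- by move=> x _; exact: pair_ge0.
- by rewrite lee_fin powR_ge0.
rewrite lte_mul_pinfty ?lee_fin ?powR_ge0//.
have mF : measurable_fun setT (finite_power rv u).
  by apply: measurable_finite_power; [exact: rv_exp.1|exact: mu_].
have mvs : measurable_fun setT (fun x => (v x)%:E `^ fine (s x)).
  by apply: measurable_poweR_fun; [exact: measurable_EFin_fun|exact: measurable_fine_fun].
have mwt : measurable_fun setT (fun x => (w x)%:E `^ fine (t x)).
  by apply: measurable_poweR_fun; [exact: measurable_EFin_fun|exact: measurable_fine_fun].
apply: (@le_lt_trans _ _ (\int[mu]_x (finite_power rv u x +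
    ((v x)%:E `^ fine (s x) + (w x)%:E `^ fine (t x))))).
  apply: ae_ge0_le_integral.
  - exact: measurableT.
  - by move=> x _; exact: pair_ge0.
  - exact: m_pair.
  - move=> x _; apply: adde_ge0; first exact: finite_power_ge0.
    by apply: adde_ge0; exact: poweR_ge0.
  - by apply: emeasurable_funD; [exact: mF|exact: emeasurable_funD].
  apply: filterS2 dual u1 => x [/andP[s0 soo] /andP[t0 too] abc] u1 _.
  set m := (X in _ <= X).
  have F0 := finite_power_ge0 rv u x.
  have V0 := poweR_ge0 (v x)%:E (fine (s x)).
  have W0 := poweR_ge0 (w x)%:E (fine (t x)).
  have VW0 := adde_ge0 V0 W0.
  have m0 : 0 <= m by exact: adde_ge0.
  rewrite -(poweR_prod3 (a := r * (fine (rv x))^-1) (b := a * (fine (s x))^-1)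
    (c := b * (fine (t x))^-1) _ _ _ abc m0).
  - apply: lee_pmul; [by apply: mule_ge0; exact: poweR_ge0|exact: poweR_ge0|..].
      apply: lee_pmul; [exact: poweR_ge0|exact: poweR_ge0|..].
        apply: le_poweR_exponent => //; [exact: ltW|exact: (rv_exp.2 x)|].
        move=> ex; rewrite (@le_trans _ _ (finite_power rv u x))//.
          by rewrite /finite_power (negbTE ex).
        exact: leeDl.
      apply: le_poweR_exponent => //; [exact: ltW|by rewrite lee_fin|..].
        by move=> sy; rewrite sy ltxx in soo.
      move=> _; apply: (@le_trans _ _ ((v x)%:E `^ fine (s x) + (w x)%:E `^ fine (t x))).
        exact: leeDl.
      exact: leeDr.
    apply: le_poweR_exponent => //; [exact: ltW|by rewrite lee_fin|..].
      by move=> sy; rewrite sy ltxx in too.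
    move=> _; apply: (@le_trans _ _ ((v x)%:E `^ fine (s x) + (w x)%:E `^ fine (t x))).
      exact: leeDr.
    exact: leeDr.
  - by apply: divr_ge0; [exact: ltW|apply: fine_ge0; apply: ltW; exact: (rv_exp.2 x)].
  - by apply: divr_ge0; [exact: ltW|apply: fine_ge0; exact: ltW].
  - by apply: divr_ge0; [exact: ltW|apply: fine_ge0; exact: ltW].
rewrite ge0_integralD; last 5 first.
- exact: measurableT.
- by move=> x _; exact: finite_power_ge0.
- exact: mF.
- by move=> x _; apply: adde_ge0; exact: poweR_ge0.
- exact: emeasurable_funD.
rewrite ge0_integralD; last 5 first.
- exact: measurableT.
- by move=> x _; exact: poweR_ge0.
- exact: mvs.
- by move=> x _; exact: poweR_ge0.
- exact: mwt.
apply: lte_add_pinfty; first exact: iF.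
by apply: lte_add_pinfty; [apply: le_lt_trans iv _|apply: le_lt_trans iw _]; exact: ltry.
Qed.

(** Put [gam = 1 - r / rv = a / s + b / t]. The lower bounds on [v] and [w] give
    [v ^ a * w ^ b >= Phi ^ gam / 2 >= c * phi ^ gam / 2], as [gam <= 1] and
    [c <= 1]; then [u ^ r * phi ^ gam], for [u = h / l], dominates [phi] up to
    [2 ^ r], and [phi] has mass at least [1 / 2]. *)
Lemma bilinear_integral_ge h (phi Phi : T -> \bar R) (l c : R) :
  (0 < l)%R -> (0 < c <= 1)%R -> nonneg_measurable h ->
  nonneg_measurable phi ->
  (forall x, c%:E * phi x <= Phi x) ->
  (\forall x \ae mu, 2^-1%:E * Phi x `^ (fine (s x))^-1 <= (v x)%:E) ->
  (\forall x \ae mu, 2^-1%:E * Phi x `^ (fine (t x))^-1 <= (w x)%:E) ->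
  (2^-1)%:E <= \int[mu]_x phi x ->
  (forall x, phi x <= (2 `^ r)%:E *
     ((h x / l%:E) `^ r * phi x `^ (1 - r * (fine (rv x))^-1))) ->
  (l `^ r)%:E <= (4 * 2 `^ r / c)%:E *
     \int[mu]_x (h x `^ r * (v x)%:E `^ a * (w x)%:E `^ b).
Proof.
move=> l0 /andP[c0 c1] [mh h0] [mphi phi0] cphi aev aew iphi phile.
pose u x := h x / l%:E.
have mu_ : measurable_fun setT u by exact: measurable_divEFin.
have u0 x : 0 <= u x by rewrite /u divEFin// mule_ge0// lee_fin invr_ge0 ltW.
have lr0 : (0 < l `^ r)%R by rewrite powR_gt0.
rewrite (eq_integral (fun x => (l `^ r)%:E * pair u x)); last first.
  by move=> x _; rewrite -pairZ.
rewrite ge0_integralZl; last 4 first.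
- exact: measurableT.
- exact: m_pair.
- by move=> x _; exact: pair_ge0.
- by rewrite lee_fin ltW.
rewrite muleCA -[leLHS]mule1; apply: lee_wpmul2l; first by rewrite lee_fin ltW.
have k0 : (0 <= 2 * 2 `^ r / c)%R by rewrite divr_ge0 ?mulr_ge0 ?powR_ge0// ltW.
suff : \int[mu]_x phi x <= (2 * 2 `^ r / c)%:E * \int[mu]_x pair u x.
  move=> ple; have -> : (4 * 2 `^ r / c = 2 * (2 * 2 `^ r / c))%R.
    by rewrite !mulrA -natrM.
  rewrite EFinM -muleA; apply: (@le_trans _ _ (2%:E * (2^-1)%:E)).
    by rewrite -EFinM divff.
  by apply: lee_wpmul2l; [rewrite lee_fin|exact: le_trans iphi ple].
rewrite -ge0_integralZl; last 4 first.
- exact: measurableT.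
- exact: m_pair.
- by move=> x _; exact: pair_ge0.
- by rewrite lee_fin.
apply: ae_ge0_le_integral.
- exact: measurableT.
- by move=> x _; exact: phi0.
- exact: mphi.
- by move=> x _; apply: mule_ge0; [rewrite lee_fin|exact: pair_ge0].
- by apply: emeasurable_funM; [exact: measurable_cst|exact: m_pair].
apply: filterS3 dual aev aew => x [/andP[s0 soo] /andP[t0 too] abc] vx wx _.
set al := (fine (s x))^-1%R in vx abc; set be := (fine (t x))^-1%R in wx abc.
have al0 : (0 < al)%R by rewrite invr_gt0 fine_gt0// s0.
have be0 : (0 < be)%R by rewrite invr_gt0 fine_gt0// t0.
have g0 : (0 <= r * (fine (rv x))^-1)%R.
  by apply: divr_ge0; [exact: ltW|apply: fine_ge0; apply: ltW; exact: (rv_exp.2 x)].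
set g := (1 - r * (fine (rv x))^-1)%R.
have gE : (g = al * a + be * b)%R.
  by rewrite /g -abc; ring.
have gpos : (0 < g)%R by rewrite gE addr_gt0 ?mulr_gt0.
have g1 : (g <= 1)%R by rewrite gerBl.
have Phi0 : 0 <= Phi x by apply: le_trans (cphi x); rewrite mule_ge0// lee_fin ltW.
have vw : 2^-1%:E * (c%:E * phi x `^ g) <= (v x)%:E `^ a * (w x)%:E `^ b.
  apply: (@le_trans _ _ ((2^-1%:E * Phi x `^ al) `^ a * (2^-1%:E * Phi x `^ be) `^ b)).
    rewrite !poweRM ?poweR_ge0 ?lee_fin// muleACA poweR_prod2 ?lee_fin//; try exact: ltW.
    apply: lee_wpmul2l; first by rewrite lee_fin.
    rewrite -!poweRrM -poweRD; last by apply: add_neq0_poweRD_def; rewrite -gE gt_eqF.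
    rewrite -gE; apply: (@le_trans _ _ ((c%:E * phi x) `^ g)); last first.
      apply: le_poweR2; [exact: ltW| |exact: cphi].
      by rewrite mule_ge0// lee_fin ltW.
    rewrite poweRM ?lee_fin//; last exact: ltW.
    apply: lee_wpmul2r; first exact: poweR_ge0.
    by rewrite poweR_EFin lee_fin; apply: ger1_powR => //; rewrite c0 c1.
  apply: lee_pmul; [exact: poweR_ge0|exact: poweR_ge0|..].
    apply: le_poweR2; [exact: ltW| |exact: vx].
    by apply: mule_ge0; [rewrite lee_fin|exact: poweR_ge0].
  apply: le_poweR2; [exact: ltW| |exact: wx].
  by apply: mule_ge0; [rewrite lee_fin|exact: poweR_ge0].
apply: (le_trans (phile x)).
have -> : (2 * 2 `^ r / c = 2 `^ r * (2 / c))%R by rewrite mulrAC mulrC.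
rewrite EFinM -muleA; apply: lee_wpmul2l; first by rewrite lee_fin powR_ge0.
rewrite /pair -!muleA [leRHS]muleCA; apply: lee_wpmul2l; first exact: poweR_ge0.
apply: (@le_trans _ _ ((2 / c)%:E * (2^-1%:E * (c%:E * phi x `^ g)))); last first.
  by apply: lee_wpmul2l; [rewrite lee_fin divr_ge0// ltW|exact: vw].
rewrite !muleA -!EFinM (_ : 2 / c / 2 * c = 1)%R ?mul1e//.
by rewrite mulrAC divfK ?gt_eqF// divff.
Qed.

End bilinear.

(** * The extrapolation theorem *)

Section assembly.
Context {R : realType} {n : nat}.
Local Notation T := (Rn R n).
Local Notation mu := (@leb R n).
Implicit Types (s : T -> \bar R).

(** The [s]-th power of [Phi ^ (1 / s)] is [Phi], so its modular is at most [1]. *)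
Lemma A1_weight_of_density s (Phi : T -> \bar R) :
  maximal_bounded s -> (\forall x \ae mu, s x < +oo) ->
  nonneg_measurable Phi -> \int[mu]_x Phi x <= 1 ->
  exists v : T -> R, [/\ A1 v,
    \forall x \ae mu, 2^-1%:E * Phi x `^ (fine (s x))^-1 <= (v x)%:E &
    \int[mu]_x ((v x)%:E `^ fine (s x)) <= 2%:E].
Proof.
move=> sB sfin [mPhi Phi0] iPhi; have [[ms s1] _] := sB.
have mfs : measurable_fun setT (fun x => fine (s x)).
  by apply: measurableT_comp => //; exact: fine_measurable.
have mG : measurable_fun setT (fun x => Phi x `^ (fine (s x))^-1).
  apply: measurable_poweR_fun; first exact: mPhi.
  rewrite (_ : (fun _ => _) = (fun x => fine (s x) `^ (-1))%R); last first.
    by apply/funext => x; rewrite powR_inv1// fine_ge0// (le_trans lee01).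
  apply: (measurableT_comp (f := fun y : R => (y `^ (-1))%R)) mfs.
  exact: measurable_powR.
apply: rubio_de_francia => //; first by move=> x; exact: poweR_ge0.
rewrite (modular_ae_fin ms mG sfin); apply: le_trans iPhi.
apply: ae_ge0_le_integral.
- exact: measurableT.
- by move=> x _; exact: poweR_ge0.
- by apply: measurable_poweR_fun; [exact: measurableT_comp|exact: mfs].
- by move=> x _; exact: Phi0.
- exact: mPhi.
apply: filterS sfin => x sx _; rewrite gee0_abs ?poweR_ge0// -poweRrM mulVf ?poweRe1//.
by rewrite gt_eqF// fine_gt0// sx (lt_le_trans lte01).
Qed.

Lemma common_density (phi : nat -> T -> \bar R) :
  (forall k, nonneg_measurable (phi k)) -> (forall k, \int[mu]_x phi k x <= 1) ->
  exists Phi : T -> \bar R, [/\ nonneg_measurable Phi, \int[mu]_x Phi x <= 1 &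
    forall k x, (2 ^- k.+1)%:E * phi k x <= Phi x].
Proof.
move=> phiP iphi.
have mphi k : measurable_fun setT (phi k) by case: (phiP k).
have phi0 k x : 0 <= phi k x by case: (phiP k).
have mcphi k : measurable_fun setT (fun x => (2 ^- k.+1)%:E * phi k x).
  by apply: emeasurable_funM; [exact: measurable_cst|exact: mphi].
have cphi0 k x : 0 <= (2 ^- k.+1)%:E * phi k x.
  by rewrite mule_ge0// lee_fin.
exists (fun x => \sum_(k <oo) (2 ^- k.+1)%:E * phi k x); split.
- split; last by move=> x; exact: nneseries_ge0.
  by apply: ge0_emeasurable_sum.
- rewrite integral_nneseries//.
  apply: le_trans (nneseries_half_le lee01).
  apply: lee_nneseries => [k _ _|k _]; first exact: integral_ge0.
  rewrite ge0_integralZl//.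
  by apply: lee_wpmul2l; [rewrite lee_fin|exact: iphi].
- move=> k x; apply: le_trans; last exact: (nneseries_lim_ge k.+1).
  by rewrite big_nat_recr//= leeDr// sume_ge0.
Qed.

Lemma conj_exponent_ae (p : R) (pv : T -> \bar R) :
  let s := conj_exponent (fun x => pv x / p%:E) in
  (0 < p)%R -> p%:E < ess_inf mu pv -> maximal_bounded s ->
  \forall x \ae mu, [/\ 0 < s x, s x < +oo &
    (p * (fine (pv x))^-1 + (fine (s x))^-1 = 1)%R].
Proof.
move=> s p0 /ereal_sup_gt[y yP py] [[_ s1] _].
apply: filterS yP => x yx.
have [soo ps] := hoelder_conjugate_fine p0 (lt_le_trans py yx).
by split => //; exact: lt_le_trans (s1 x).
Qed.

End assembly.

(* The constant C0 of the hypothesis is a function of the two A_1 constants,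
   and C is chosen before the family F. *)
Theorem theorem3p1 (R : realType) (n : nat) (p q r : R)
    (C0 : \bar R -> \bar R -> R) (pv qv rv : Rn R n -> \bar R)
    (p_gt0 : (0 < p)%R) (q_gt0 : (0 < q)%R) (r_gt0 : (0 < r)%R)
    (rpq : (r^-1 = p^-1 + q^-1)%R)
    (pv_exp : exponentP0 pv) (qv_exp : exponentP0 qv) (rv_exp : exponentP0 rv)
    (rpqv : forall x, (rv x)^-1 = (pv x)^-1 + (qv x)^-1)
    (p_lt : p%:E < ess_inf (@leb R n) pv) (q_lt : q%:E < ess_inf (@leb R n) qv)
    (pB : maximal_bounded (conj_exponent (fun x => pv x / p%:E)))
    (qB : maximal_bounded (conj_exponent (fun x => qv x / q%:E))) :
  exists C : R,
  forall F : set ((Rn R n -> \bar R) * (Rn R n -> \bar R) * (Rn R n -> \bar R)),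
    (forall h f g, F (h, f, g) ->
      [/\ nonneg_measurable h, nonneg_measurable f & nonneg_measurable g]) ->
    (forall v w : Rn R n -> R, A1 v -> A1 w -> forall h f g, F (h, f, g) ->
      let lhs := (\int[@leb R n]_x
        (h x `^ r * (v x)%:E `^ (r / p) * (w x)%:E `^ (r / q))) `^ r^-1 in
      lhs < +oo ->
      lhs <= (C0 (A1_const v) (A1_const w))%:E *
             (\int[@leb R n]_x (f x `^ p * (v x)%:E)) `^ p^-1 *
             (\int[@leb R n]_x (g x `^ q * (w x)%:E)) `^ q^-1) ->
    forall h f g, F (h, f, g) -> var_Lp rv h ->
      var_norm rv h <= C%:E * var_norm pv f * var_norm qv g.
Proof.
pose T := Rn R n; pose mu := @leb R n.
pose s := conj_exponent (fun x => pv x / p%:E).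
pose t := conj_exponent (fun x => qv x / q%:E).
have sP := conj_exponent_ae p_gt0 p_lt pB.
have tP := conj_exponent_ae q_gt0 q_lt qB.
have [[ms _] _] := pB; have [[mt _] _] := qB.
have ab := sum_scaled_exponents p_gt0 q_gt0 r_gt0 rpq.
have a0 : (0 < r / p)%R by rewrite divr_gt0.
have b0 : (0 < r / q)%R by rewrite divr_gt0.
have dual : \forall x \ae mu, [/\ 0 < s x < +oo, 0 < t x < +oo &
    (r * (fine (rv x))^-1 + r / p * (fine (s x))^-1 +
     r / q * (fine (t x))^-1 = 1)%R].
  apply: filterS2 sP tP => x [s0 soo ps] [t0 too qt]; rewrite s0 soo t0 too.
  split=> //; rewrite (fine_inveD _ _ _ (rpqv x)); last 3 first.
  - exact: (rv_exp.2 x).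
  - exact: (pv_exp.2 x).
  - exact: (qv_exp.2 x).
  move: ps qt; rewrite -/s -/t.
  move: (fine (pv x))^-1%R (fine (qv x))^-1%R (fine (s x))^-1%R (fine (t x))^-1%R.
  move=> P Q S U pS qU.
  have -> : (S = 1 - p * P)%R by rewrite -pS [X in (X - _)%R]addrC addrK.
  have -> : (U = 1 - q * Q)%R by rewrite -qU [X in (X - _)%R]addrC addrK.
  by rewrite -[RHS]ab; field; rewrite !gt_eqF.
(* [B k] is the constant of [bilinear_integral_ge] for [c = 2 ^- k.+1], the share
   of the [k]-th triple in the common density; the factor [k.+1] in [N k] is the
   excess that leads to the contradiction. *)
pose B k : R := (4 * 2 `^ r / 2 ^- k.+1)%R.
have B0 k : (0 < B k)%R by rewrite divr_gt0 ?mulr_gt0 ?powR_gt0 ?invr_gt0 ?exprn_gt0.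
pose N k : R := (k.+1%:R * B k `^ r^-1)%R.
have N0 k : (0 < N k)%R by rewrite mulr_gt0 ?powR_gt0.
apply: contrapT => noC.
pose bad k (z : (T -> \bar R) * (T -> \bar R) * (T -> \bar R) * R) :=
  [/\ [/\ nonneg_measurable z.1.1.1, nonneg_measurable z.1.1.2 & nonneg_measurable z.1.2],
      var_Lp rv z.1.1.1,
      (0 < z.2)%R /\ (N k)%:E * var_norm pv z.1.1.2 * var_norm qv z.1.2 < z.2%:E,
      1 < modular rv (fun x => z.1.1.1 x / z.2%:E) &
      forall v w : T -> R, A1 v -> A1 w ->
      let lhs := (\int[mu]_x (z.1.1.1 x `^ r * (v x)%:E `^ (r / p) *
        (w x)%:E `^ (r / q))) `^ r^-1 in
      lhs < +oo ->
      lhs <= (C0 (A1_const v) (A1_const w))%:E *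
             (\int[mu]_x (z.1.1.2 x `^ p * (v x)%:E)) `^ p^-1 *
             (\int[mu]_x (z.1.2 x `^ q * (w x)%:E)) `^ q^-1].
have /choice[z zP] k : exists y, bad k y.
  apply: contrapT => nz; apply: noC; exists (N k) => F F0 FC h f g Fh hLp.
  apply: contrapT => /negP; rewrite -ltNge => lth; apply: nz.
  have [h0 f0 g0] := F0 _ _ _ Fh.
  have [|l [l0 ll lh]] := lt_ereal_real_between _ lth.
    by rewrite !mule_ge0 ?var_norm_ge0// lee_fin ltW.
  exists (h, f, g, l); split => //=; first exact: modular_gt1.
  by move=> v w Av Aw; exact: FC.
have /choice[phi phiP] k : exists phi : T -> \bar R,
    [/\ nonneg_measurable phi, \int[mu]_x phi x <= 1, (2^-1)%:E <= \int[mu]_x phi x &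
    forall x, phi x <= (2 `^ r)%:E * (((z k).1.1.1 x / (z k).2%:E) `^ r *
      phi x `^ (1 - r * (fine (rv x))^-1))].
  have [[[mh h0] _ _] _ [l0 _] m1 _] := zP k.
  have [|x|phi [mphi phi0 ? ? ?]] := norming_density rv_exp _ _ r_gt0 m1.
  - exact: measurable_divEFin.
  - by rewrite divEFin// mule_ge0// lee_fin invr_ge0 ltW.
  - by exists phi.
have [Phi [PhiP iPhi cPhi]] : exists Phi : T -> \bar R,
    [/\ nonneg_measurable Phi, \int[mu]_x Phi x <= 1 &
    forall k x, (2 ^- k.+1)%:E * phi k x <= Phi x].
  by apply: common_density => k; have [] := phiP k.
have sfin : \forall x \ae mu, s x < +oo by apply: filterS sP => x [].
have tfin : \forall x \ae mu, t x < +oo by apply: filterS tP => x [].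
have [v [Av vPhi iv]] := A1_weight_of_density pB sfin PhiP iPhi.
have [w [Aw wPhi iw]] := A1_weight_of_density qB tfin PhiP iPhi.
have [[mv v0 _] _] := Av; have [[mw w0 _] _] := Aw.
pose D := (`|C0 (A1_const v) (A1_const w)| * (3 `^ p^-1 * 3 `^ q^-1))%R.
have D0 : (0 <= D)%R by rewrite mulr_ge0// mulr_ge0// powR_ge0.
suff bound k : (k.+1%:R <= D)%R.
  have := bound (Num.bound D); rewrite leNgt => /negP; apply.
  by rewrite (lt_le_trans (archi_boundP D0))// ler_nat.
have [[h0 f0 g0] hLp [l0 Nl] _ hyp] := zP k.
have [phik0 _ iphik phile] := phiP k.
set h := (z k).1.1.1 in h0 hLp hyp phile; set f := (z k).1.1.2 in f0 Nl hyp.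
set g := (z k).1.2 in g0 Nl hyp; set l := (z k).2 in l0 Nl phile.
have Lfin := bilinear_integral_lty a0 b0 r_gt0 rv_exp ms mt dual mv mw v0 w0 h0 hLp iv iw.
have c01 : (0 < (2 ^- k.+1 : R) <= 1)%R.
  by rewrite invr_gt0 exprn_gt0//=; rewrite ?invf_le1 ?exprn_gt0// exprn_ege1// ler1n.
have Lge := bilinear_integral_ge a0 b0 ab r_gt0 rv_exp dual mv mw l0 c01
  h0 phik0 (cPhi k) vPhi wPhi iphik phile.
have {hyp} := hyp v w Av Aw.
set L := \int[mu]_x (_ * _ * _) in Lfin Lge *.
have L0 : 0 <= L.
  apply: integral_ge0 => x _; apply: mule_ge0; last exact: poweR_ge0.
  by apply: mule_ge0; exact: poweR_ge0.
move=> /(_ (poweR_lty _ Lfin)) Lle.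
have {}Lle : L `^ r^-1 <= D%:E * (var_norm pv f * var_norm qv g).
  apply: (le_trans Lle); rewrite /D EFinM -muleA.
  apply: (@le_trans _ _ (`|C0 (A1_const v) (A1_const w)|%:E *
    ((\int[mu]_x (f x `^ p * (v x)%:E)) `^ p^-1 *
     (\int[mu]_x (g x `^ q * (w x)%:E)) `^ q^-1))).
    apply: lee_wpmul2r; first by apply: mule_ge0; exact: poweR_ge0.
    by rewrite lee_fin ler_norm.
  rewrite -muleA; apply: lee_wpmul2l; first by rewrite lee_fin.
  rewrite EFinM muleACA; apply: lee_pmul; [exact: poweR_ge0|exact: poweR_ge0|..].
    exact: (pairing_var_norm_le p_gt0 pv_exp ms sP).
  exact: (pairing_var_norm_le q_gt0 qv_exp mt tP).
have lB : l%:E <= (B k `^ r^-1)%:E * L `^ r^-1.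
  rewrite -poweR_EFin -poweRM//; last by rewrite lee_fin ltW.
  rewrite [leLHS](_ : _ = (l `^ r)%:E `^ r^-1); last first.
    by rewrite poweR_EFin -powRrM divff ?gt_eqF// powRr1// ltW.
  apply: le_poweR2; [by rewrite invr_ge0 ltW|by rewrite lee_fin powR_ge0|exact: Lge].
rewrite -lee_fin -(@lee_pmul2r _ l%:E)//.
apply: (@le_trans _ _ (D%:E * ((N k)%:E * var_norm pv f * var_norm qv g))); last first.
  by apply: lee_wpmul2l; [rewrite lee_fin|exact: ltW].
have -> : (N k)%:E = k.+1%:R%:E * (B k `^ r^-1)%:E by [].
rewrite -!muleA [leRHS]muleCA.
apply: lee_wpmul2l; first by rewrite lee_fin.
rewrite [leRHS]muleCA; apply: (le_trans lB); apply: lee_wpmul2l.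
  by rewrite lee_fin powR_ge0.
exact: Lle.
Qed.
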